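(* The Whittaker vectors $\mathfrak k=\sum_{\underline d}\mathfrak k_{\underline d}$ and $\mathfrak w=\sum_{\underline d}\mathfrak w_{\underline d}$ are given as follows. (a) $\mathfrak k_{\underline d}=[\mathcal O_{\mathfrak Q_{\underline d}}]$, the class of the structure sheaf of $\mathfrak Q_{\underline d}$. (b) $\mathfrak w_{\underline d}=v^{\sum_{i=1}^{n-1}(1-2i)d_i^2-\sum_{i=2}^{n-1}(2-2i)d_id_{i-1}-\sum_{i=1}^{n-1}d_i}\prod_{i=1}^nt_i^{(2-2i)(d_{i-1}-d_i)}\,[\mathfrak D_{\underline d}^{-1}]$.
   Context: Work over $\mathbb C$; $n\ge2$. Geometry: $\mathbf C=\mathbb P^1$ with coordinate $z$ and points $0,\infty$; $\mathbb C^*$ acts by $v(z)=v^{-2}z$. $W$ is a vector space with basis $w_1,\dots,w_n$; the torus $\widetilde T=\{(t_1,\dots,t_n): t_1\cdots t_n=1\}$ acts on $W$ by $\underline t(w_i)=t_i^2w_i$. For $\underline d=(d_1,\dots,d_{n-1})\in\mathbb Z_{\ge0}^{n-1}$ (with $d_0=d_n=0$), $\mathfrak Q_{\underline d}$ is the moduli space of flags of locally free subsheaves $0\subset\mathcal W_1\subset\dots\subset\mathcal W_{n-1}\subset W\otimes\mathcal O_{\mathbf C}$ with $\operatorname{rank}\mathcal W_k=k$, $\deg\mathcal W_k=-d_k$, such that near $\infty$ each $\mathcal W_i$ is a vector subbundle with fibre $\langle w_1,\dots,w_i\rangle$ at $\infty$. It is a smooth quasiprojective variety of dimension $2\sum d_i$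 with an action of $\widetilde T\times\mathbb C^*$ (it is empty if some $d_i<0$). Write $\underline d\pm i$ for $\underline d$ with $d_i$ replaced by $d_i\pm1$. $\mathfrak E_{\underline d,i}\subset\mathfrak Q_{\underline d}\times\mathfrak Q_{\underline d+i}$ is the (smooth) correspondence of pairs $(\mathcal W_\bullet,\mathcal W'_\bullet)$ with $\mathcal W_j=\mathcal W'_j$ for $j\ne i$ and $\mathcal W'_i\subset\mathcal W_i$; $\mathbf p,\mathbf q$ are its projections to $\mathfrak Q_{\underline d}$ and $\mathfrak Q_{\underline d+i}$; $\mathfrak L_i$ is the line bundle on it with fibre $\Gamma(\mathbf C,\mathcal W_i/\mathcal W'_i)$. $K$-theory: $\mathbb F=\operatorname{Frac}(\mathbb C[\widetilde T\times\mathbb C^*])$, with $\mathbb C[\widetilde T\times\mathbb C^*]=\mathbb C[t_1^{\pm1},\dots,t_n^{\pm1},v^{\pm1}]/(t_1\cdots t_n-1)$. $M_{\underline d}=K^{\widetilde T\times\mathbb C^*}(\mathfrak Q_{\underline d})\otimes\mathbb F$ (complexified equivariant $K$-theory, localized) and $M=\bigoplus_{\underline d}M_{\underline d}$. The $\widetilde T\times\mathbb C^*$-fixed points of $\mathfrak Q_{\underline d}$ are indexed by collections $\widetilde{\underline d}=(d_{ij})_{1\le j\le i\le n-1}$ of nonnegative integers with $d_i=\sum_{j\le i}d_{ij}$ and $d_{kj}\ge d_{ij}$ for $i\ge k\ge j$; the corresponding flag is $\mathcal W_i=\bigoplus_{j\le i}\mathcal O_{\mathbf C}(-d_{ij}\cdot0)w_j$.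 The classes $[\widetilde{\underline d}]$ of the structure sheaves of the fixed points form an $\mathbb F$-basis of $M$. Convention for characters and direct images: the function $z$ has character $v^{-2}$ and $w_i$ has character $t_i^2$, so e.g. $\operatorname{Hom}(\mathcal O_{\mathbf C}(-a\cdot 0),\mathcal O_{\mathbf C})$ has character $\sum_{c=0}^av^{2c}$. At a fixed point $x$ of a smooth variety $X$ put $S\chi_x=\prod_\chi(1-\chi)^{-1}$, the product over the weights $\chi$ of $T_xX$ (the character of $\operatorname{Sym}^\bullet T_xX$). A class $\mathcal G\in M_{\underline d}$ equals $\sum_{x}\mathcal G|_x\,S\chi_x\,[x]$, sum over fixed points. Direct images are defined by localization: $\mathbf p_*\mathbf q^*[\widetilde{\underline d}{}']=\sum_{\widetilde{\underline d}}\frac{S\chi_{(\widetilde{\underline d},\widetilde{\underline d}{}')}}{S\chi_{\widetilde{\underline d}{}'}}[\widetilde{\underline d}]$ and $\mathbf q_*(\mathfrak L_i\otimes\mathbf p^* )[\widetilde{\underline d}]=\sum_{\widetilde{\underline d}{}'}\lambda\,\frac{S\chi_{(\widetilde{\underline d},\widetilde{\underline d}{}')}}{S\chi_{\widetilde{\underline d}}}[\widetilde{\underline d}{}']$, sums over fixed points $(\widetilde{\underline d},\widetilde{\underline d}{}')$ of $\mathfrak E_{\underline d,i}$, $\lambda$ the character of the fibre of $\mathfrak L_i$ there. Operators, for $1\le i\le n-1$, given by their restriction to $M_{\underline d}$: $K_i=t_{i+1}t_i^{-1}v^{2d_i-d_{i-1}-d_{i+1}+1}:M_{\underline d}\to M_{\underline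 d}$; $f_i=\mathbf p_*\mathbf q^*:M_{\underline d}\to M_{\underline d-i}$; $e_i=-t_{i+1}^{-1}t_i^{-1}v^{d_{i+1}-d_{i-1}}\,\mathbf q_*(\mathfrak L_i\otimes\mathbf p^* ):M_{\underline d}\to M_{\underline d+i}$. Put $E_i=e_iK_i^{-i}$, $F_i=K_i^if_i$; the $E_i,F_i$ make $M$ the universal Verma module over $U_v(\mathfrak{sl}_n)$ with lowest weight vector $[(0,\dots,0)]$. The Shapovalov form on $M$ is the symmetric $\mathbb F$-bilinear form with $([(0,\dots,0)],[(0,\dots,0)])=1$ and $(E_ix,y)=(x,F_iy)$; $e_i^*$ denotes the adjoint of $e_i$ with respect to it, so $e_i^*=K_i^{2i}f_i$. Whittaker vectors: in the completion $\prod_{\underline d}M_{\underline d}$ of $M$ there is a unique vector $\mathfrak k=\sum_{\underline d}\mathfrak k_{\underline d}$ (resp. $\mathfrak w=\sum_{\underline d}\mathfrak w_{\underline d}$), with $\mathfrak k_{\underline d},\mathfrak w_{\underline d}\in M_{\underline d}$, such that $\mathfrak k_{(0,\dots,0)}=\mathfrak w_{(0,\dots,0)}=[(0,\dots,0)]$ and $f_i\mathfrak k=(1-v^2)^{-1}\mathfrak k$ (resp. $e_i^*\mathfrak w=(1-v^2)^{-1}\mathfrak w$) for all $1\le i\le n-1$. $\mathfrak D_i$ is the line bundle on $\mathfrak Q_{\underline d}$ whose fibre at $\mathcal W_\bullet$ equals $\det R\Gamma(\mathbf C,\mathcal W_i)$, and $\mathfrak D_{\underline d}=\bigotimes_{i=1}^{n-1}\mathfrak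 D_i$.
   Formalization: In (b) the right side is multiplied by the character of the fibre of D at the point of Q_0, i.e. the product of t_j^2 over 1≤j≤i≤n-1; without this constant (independent of d) the formula at d=0 contradicts w_0=[(0,...,0)]. *)

(* Defs.v *)
From HB Require Import structures.
From mathcomp Require Import all_boot all_order all_algebra.
From mathcomp Require Import finmap classical_sets fsbigop reals complex.
From mathcomp Require Import mpoly.
From mathcomp Require Import monalg.

Set Implicit Arguments.
Unset Strict Implicit.
Unset Printing Implicit Defensive.

Import Order.TTheory GRing.Theory Num.Theory.
Local Open Scope ring_scope.

(* All families w_1, ..., w_n, t_1, ..., t_n, d_1, ..., d_{n-1}, (d_{ij}) are
   indexed by natural numbers starting from 1, as in the mathematics.  The
   complex numbers are R[i] for R : realType. *)

(** ** The field F = Frac C[T~ x C^*] *)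

(* The relation t_1 ... t_n = 1 is used to eliminate t_n: the coordinate ring
   is C[t_1^{+-1}, ..., t_{n-1}^{+-1}, v^{+-1}], whose fraction field is the
   field of rational functions in n variables; the variables 0, ..., n-2 are
   t_1, ..., t_{n-1} and the variable n-1 is v. *)
Definition Ffield (R : realType) (n : nat) : fieldType :=
  {fraction (mpoly.mpoly n R[i])}.

Definition Fvar (R : realType) (n k : nat) : Ffield R n :=
  if insub k is Some o then
    @FracField.tofrac (mpoly.mpoly n R[i]) (mpoly.mpolyX _ (mpoly.mnm1 o))
  else 0.

Definition vv (R : realType) (n : nat) : Ffield R n := Fvar R n n.-1.

Definition tvar (R : realType) (n k : nat) : Ffield R n :=
  if k == n then (\prod_(0 <= j < n.-1) Fvar R n j)^-1 else Fvar R n k.-1.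

(** ** Degrees and fixed points *)

Notation degree n := (n.-1.-tuple nat).

(* d_i, with d_0 = d_n = 0 *)
Definition dg (n : nat) (d : degree n) (i : nat) : nat :=
  nth 0%N (0%N :: d) i.

Definition deg0 (n : nat) : degree n := [tuple 0%N | k < n.-1].

(* d + i *)
Definition incr (n : nat) (d : degree n) (i : nat) : degree n :=
  [tuple (tnth d k + (k.+1 == i))%N | k < n.-1].

(* d_{ij}, for 1 <= i and 1 <= j *)
Definition sent (s : seq (seq nat)) (i j : nat) : nat :=
  nth 0%N (nth [::] s i.-1) j.-1.

(* A triangular array with rows of lengths 1, ..., n-1, such that
   d_{kj} >= d_{ij} for i >= k >= j. *)
Definition is_fixpt (n : nat) (s : seq (seq nat)) : bool :=
  (shape s == iota 1 n.-1) &&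
  all (fun i => all (fun k => all (fun j => sent s i j <= sent s k j)%N
    (iota 1 k)) (iota 1 i)) (iota 1 n.-1).

Definition fixpt (n : nat) : choiceType := {s : seq (seq nat) | is_fixpt n s}.

Definition ent (n : nat) (x : fixpt n) (i j : nat) : nat := sent (val x) i j.

Definition fdeg (n : nat) (x : fixpt n) : degree n :=
  [tuple \sum_(1 <= j < k.+2) ent x k.+1 j | k < n.-1]%N.

Lemma fixpt0_proof (n : nat) :
  is_fixpt n [seq nseq i 0%N | i <- iota 1 n.-1].
Proof.
have E i j : sent [seq nseq i 0%N | i <- iota 1 n.-1] i j = 0%N.
  rewrite /sent; case: (ltnP i.-1 (size (iota 1 n.-1))) => h.
    by rewrite (nth_map 0%N) // nth_nseq if_same.
  by rewrite [nth [::] _ _]nth_default ?size_map // nth_nil.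
apply/andP; split.
  by rewrite /shape -map_comp -[X in _ == X]map_id; apply/eqP/eq_map => i /=;
     rewrite size_nseq.
by do 3!apply/allP => ? _; rewrite !E.
Qed.

(* the unique point of Q_{(0,...,0)} *)
Definition fixpt0 (n : nat) : fixpt n := Sub _ (fixpt0_proof n).

(* (x, y) is a fixed point of E_{d,i} with d = fdeg x: W_j = W'_j for j <> i,
   W'_i is contained in W_i, and y lies in Q_{d+i}. *)
Definition incident (n : nat) (i : nat) (x y : fixpt n) : bool :=
  [&& fdeg y == incr (fdeg x) i,
      all (fun k => (k != i) ==>
        all (fun j => ent y k j == ent x k j) (iota 1 k)) (iota 1 n.-1)
    & all (fun j => ent x i j <= ent y i j)%N (iota 1 i)].

(** ** Tangent spaces at the fixed points *)

(* MSheaf r a is the subsheaf (+)_{1 <= j <= r} O(- a_j 0) w_j of W (x) O. *)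
Record msheaf := MSheaf { rk : nat; vord : nat -> nat }.

Definition flagW (n : nat) (x : fixpt n) (i : nat) : msheaf :=
  MSheaf i (ent x i).

(* W_1 < ... < W_{n-1} *)
Definition chainQ (n : nat) (x : fixpt n) : seq msheaf :=
  [seq flagW x k | k <- iota 1 n.-1].

(* W_1 < ... < W_{i-1} < W'_i < W_i < W_{i+1} < ... < W_{n-1} *)
Definition chainE (n : nat) (i : nat) (x y : fixpt n) : seq msheaf :=
  [seq flagW x k | k <- iota 1 i.-1] ++
  flagW y i :: [seq flagW x k | k <- iota i (n - i)].

(* The tangent space at a chain S_0 < ... < S_{m-1} of subsheaves of W (x) O
   (prescribed at infinity) is the space of the families
     phi_k in Hom(S_k, (W (x) O)/S_k (-infinity)),  0 <= k < m,
   such that phi_k and phi_{k+1} have the same image in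
   Hom(S_k, (W (x) O)/S_{k+1}).  For monomial sheaves everything is graded by
   the triples (j, l, e): the piece of index (j, l, e) of
   Hom(S, (W (x) O)/S' (-infinity)) is spanned by the homomorphism which
   multiplies by z^e and sends w_j to w_l; it is nonzero (and one-dimensional)
   iff  w_j occurs in S, the image z^{a_j + e} w_l of the generator is regular
   at 0, and either w_l occurs in S' and z^{a_j + e} is not in O(- a'_l 0), or
   w_l does not occur in S' and z^e vanishes at infinity.  Its character is
   t_l^2 t_j^{-2} v^{-2e}. *)
Definition has_hom (S S' : msheaf) (j l : nat) (e : int) : bool :=
  [&& (j <= rk S)%N, 0 <= (vord S j)%:Z + e &
    if (l <= rk S')%N then (vord S j)%:Z + e < (vord S' l)%:Z else e < 0].

Definition nthS (ch : seq msheaf) (k : nat) : msheaf :=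
  nth (MSheaf 0 (fun _ => 0%N)) ch k.

(* A row vector u is a family phi_k = u_k (z^e, w_j |-> w_l); it is killed by
   the first block iff u_k = 0 for all k for which this homomorphism is zero in
   Hom(S_k, (W (x) O)/S_k), and by the second one iff u_k = u_{k+1} for all k
   for which it is nonzero in Hom(S_k, (W (x) O)/S_{k+1}). *)
Definition tangent_eqs (R : realType) (ch : seq msheaf) (j l : nat) (e : int) :
    'M[R[i]]_(size ch, size ch + size ch) :=
  row_mx
    (\matrix_(k, k')
       ((k == k') && ~~ has_hom (nthS ch k) (nthS ch k) j l e)%:R)
    (\matrix_(k, k')
       (if (k'.+1 < size ch)%N && has_hom (nthS ch k') (nthS ch k'.+1) j l e
        then (k == k' :> nat)%:R - (k == k'.+1 :> nat)%:R else 0)).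

(* dimension of the (j, l, e)-piece of the tangent space *)
Definition tangent_mult (R : realType) (ch : seq msheaf) (j l : nat) (e : int)
  : nat := \rank (kermx (tangent_eqs R ch j l e)).

Definition height (n : nat) (ch : seq msheaf) : nat :=
  \max_(S <- ch) \max_(1 <= j < n.+1) vord S j.

(* The product of (1 - chi)^{-1} over the weights chi of the tangent space.
   The pieces of index (j, l, e) vanish unless - height <= e < height. *)
Definition Schi (R : realType) (n : nat) (ch : seq msheaf) : Ffield R n :=
  \prod_(1 <= j < n.+1) \prod_(1 <= l < n.+1)
  \prod_(0 <= c < height n ch + height n ch)
    let e : int := c%:Z - (height n ch)%:Z in
    (1 - tvar R n l ^+ 2 * tvar R n j ^- 2 * vv R n ^ (- (2 * e)))
      ^- tangent_mult R ch j l e.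

Definition SQ (R : realType) (n : nat) (x : fixpt n) : Ffield R n :=
  Schi R n (chainQ x).

Definition SE (R : realType) (n : nat) (i : nat) (x y : fixpt n)
  : Ffield R n :=
  Schi R n (chainE i x y).

(** ** The module M and the operators *)

(* The F-vector space with basis the classes << x >> of the fixed points. *)
Notation Mmod R n := {malg (Ffield R n)[fixpt n]}.

Definition lin_ext (R : realType) (n : nat) (g : fixpt n -> Mmod R n)
    (m : Mmod R n) : Mmod R n :=
  \sum_(x <- msupp m) mcoeff x m *: g x.

Definition in_weight (R : realType) (n : nat) (d : degree n) (m : Mmod R n)
  : Prop := forall x, x \in msupp m -> fdeg x = d.

(* The class in M_d of an equivariant sheaf with fibre characters G.  Here and
   below the sums over fixed points are over finite sets. *)
Definition Kclass (R : realType) (n : nat) (d : degree n)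
    (G : fixpt n -> Ffield R n) : Mmod R n :=
  \sum_(x \in [set x : fixpt n | fdeg x = d]%classic)
    (G x * SQ R x) *: << x >>.

(* The scalar by which K_i acts on M_d *)
Definition Kscal (R : realType) (n : nat) (i : nat) (d : degree n)
  : Ffield R n :=
  tvar R n i.+1 * (tvar R n i)^-1 *
  vv R n ^ (2 * (dg d i)%:Z - (dg d i.-1)%:Z - (dg d i.+1)%:Z + 1).

Definition Kpow (R : realType) (n : nat) (i : nat) (p : int)
  : Mmod R n -> Mmod R n :=
  lin_ext (fun x => (Kscal R i (fdeg x)) ^ p *: << x >>).

(* f_i = p_* q^* *)
Definition fop (R : realType) (n : nat) (i : nat) : Mmod R n -> Mmod R n :=
  lin_ext (fun y => \sum_(x \in [set x : fixpt n | incident i x y]%classic)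
    (SE R i x y / SQ R y) *: << x >>).

(* character of the fibre Gamma(C, W_i / W'_i) of L_i at (x, y) *)
Definition Lchar (R : realType) (n : nat) (i : nat) (x y : fixpt n)
  : Ffield R n :=
  \sum_(1 <= j < i.+1) \sum_(ent x i j <= m < ent y i j)
    tvar R n j ^+ 2 * vv R n ^- (2 * m).

Definition eop (R : realType) (n : nat) (i : nat) : Mmod R n -> Mmod R n :=
  lin_ext (fun x =>
    (- ((tvar R n i.+1)^-1 * (tvar R n i)^-1 *
        vv R n ^ ((dg (fdeg x) i.+1)%:Z - (dg (fdeg x) i.-1)%:Z))) *:
    \sum_(y \in [set y : fixpt n | incident i x y]%classic)
      (Lchar R i x y * SE R i x y / SQ R x) *: << y >>).

Definition Eop (R : realType) (n : nat) (i : nat) (m : Mmod R n) : Mmod R n :=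
  eop i (Kpow i (- i%:Z) m).

Definition Fop (R : realType) (n : nat) (i : nat) (m : Mmod R n) : Mmod R n :=
  Kpow i i%:Z (fop i m).

(** ** The Shapovalov form and Whittaker vectors *)

Definition is_shapovalov (R : realType) (n : nat)
    (B : Mmod R n -> Mmod R n -> Ffield R n) : Prop :=
  [/\ forall y, scalar (fun x => B x y),
      forall x y, B x y = B y x,
      B << fixpt0 n >> << fixpt0 n >> = 1
    & forall i, (0 < i < n)%N -> forall x y, B (Eop i x) y = B x (Fop i y)].

Definition is_adjoint (R : realType) (n : nat)
    (B : Mmod R n -> Mmod R n -> Ffield R n) (g h : Mmod R n -> Mmod R n)
  : Prop := forall x y, B (g x) y = B x (h y).

(* A vector of the completion is a family (k_d), k_d in M_d; an operator T_i
   lowering d by i acts on it by (T_i k)_d = T_i (k_{d+i}). *)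
Definition is_whittaker (R : realType) (n : nat)
    (T : nat -> Mmod R n -> Mmod R n) (k : degree n -> Mmod R n) : Prop :=
  [/\ forall d, in_weight d (k d),
      k (deg0 n) = << fixpt0 n >>
    & forall i d, (0 < i < n)%N ->
        T i (k (incr d i)) = (1 - vv R n ^+ 2)^-1 *: k d].

(** ** The determinant line bundles *)

(* Character of det RGamma(C, W_i) at x.  H^0(O(-a 0)) and H^1(O(-a 0)) have
   the bases z^m with a <= m <= 0 and z^m with 0 < m < a (Cech cocycles). *)
Definition detRG (R : realType) (n : nat) (i : nat) (x : fixpt n)
  : Ffield R n :=
  \prod_(1 <= j < i.+1)
    ((\prod_(0 <= m < 1 | (ent x i j <= m)%N)
        (tvar R n j ^+ 2 * vv R n ^- (2 * m))) /
     (\prod_(1 <= m < ent x i j) (tvar R n j ^+ 2 * vv R n ^- (2 * m)))).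

(* Character of the fibre at x of D_d.  At the point of Q_{(0,...,0)} it is
   prod_{i < n} prod_{j <= i} t_j^2, which is not 1. *)
Definition Dchar (R : realType) (n : nat) (x : fixpt n) : Ffield R n :=
  \prod_(1 <= i < n) detRG R i x.

Definition wcoef (R : realType) (n : nat) (d : degree n) : Ffield R n :=
  vv R n ^ (\sum_(1 <= i < n) (1 - 2 * i%:Z) * (dg d i)%:Z ^+ 2
            - \sum_(2 <= i < n) (2 - 2 * i%:Z) * (dg d i)%:Z * (dg d i.-1)%:Z
            - \sum_(1 <= i < n) (dg d i)%:Z) *
  \prod_(1 <= i < n.+1)
    tvar R n i ^ ((2 - 2 * i%:Z) * ((dg d i.-1)%:Z - (dg d i)%:Z)).

(* Main.v *)
(* At a torus fixed point the equations of the tangent space of a chain of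
   monomial sheaves S_0 < S_1 < ... split into graded pieces, each a path graph
   whose equations are independent.  Hence S chi of the chain equals
     prod_k h(S_k, S_{k+1}) / prod_k h(S_k, S_k)
   for an explicit product h(S, T) of factors 1 - chi.  If the fixed point y is
   obtained from x by adding a box in column p of row i, all but four factors
   cancel in S chi_(x,y) / S chi_x; with X_j, Y_j the inverse characters of the
   generators of W_i and W_{i-1} at x, this ratio is
     (1 - v^2)^{-1} prod_j (X_p - Y_j) / prod_{j <> p} (X_p - X_j).
   So (a) is the Lagrange identity saying that these ratios have sum
   (1 - v^2)^{-1}, and (b) is the same identity with the extra weight X_p^{-1},
   that is, with an additional node 0.
   Uniqueness and e_i^* = K_i^{2i} f_i rest on a triangularity: removing from
   y <> 0 the last box of its first nonzero column gives some x such that all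
   other y' lying above x are obtained from y by moving this box to the right.
   It follows that a vector killed by all f_i is a multiple of the vacuum, that
   distinct weight spaces are orthogonal for the Shapovalov form, and that the
   form is nondegenerate. *)

Require Import Defs.
From HB Require Import structures.
From mathcomp Require Import all_boot all_order all_algebra.
From mathcomp Require Import finmap classical_sets cardinality fsbigop.
From mathcomp Require Import reals complex.
From mathcomp Require Import mpoly.
From mathcomp Require Import monalg.
From mathcomp Require Import zify ring.

Set Implicit Arguments.
Unset Strict Implicit.
Unset Printing Implicit Defensive.

Import Order.TTheory GRing.Theory Num.Theory.
Local Open Scope ring_scope.

(* monalg also defines a constant named [fdeg]. *)
Local Notation fdeg := Defs.fdeg.

(** * Lagrange sums and a rank computation *)

Lemma lagrange_lead (F : fieldType) (xs : seq F) (f : {poly F}) :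
  uniq xs -> (size f <= size xs)%N ->
  \sum_(x <- xs) f.[x] / \prod_(y <- xs | y != x) (x - y) = f`_(size xs).-1.
Proof.
move=> Uxs szf.
pose L x := \prod_(y <- xs | y != x) ('X - y%:P) : {poly F}.
have LE x : x \in xs -> L x = \prod_(y <- rem x xs) ('X - y%:P).
  by move=> _; rewrite rem_filter // big_filter.
have szL x : x \in xs -> size (L x) = size xs.
  by move=> xs_x; rewrite LE // size_prod_XsubC size_rem // prednK //;
     case: (xs) xs_x.
have LD x : (L x).[x] = \prod_(y <- xs | y != x) (x - y).
  by rewrite horner_prod; apply: eq_bigr => y _; rewrite hornerXsubC.
have L0 x : (L x).[x] != 0.
  by rewrite LD prodf_seq_neq0; apply/allP => y _; apply/implyP;
     rewrite subr_eq0 eq_sym.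
have Lx x z : z \in xs -> z != x -> (L x).[z] = 0.
  move=> xs_z zx; rewrite horner_prod (big_rem z) //= zx hornerXsubC subrr.
  by rewrite mul0r.
pose g := \sum_(x <- xs) (f.[x] / (L x).[x]) *: L x.
have fg : f = g.
  apply/eqP; rewrite -subr_eq0; apply/eqP.
  apply: (@roots_geq_poly_eq0 _ _ xs) => //.
    apply/allP => z xs_z; rewrite rootE hornerD hornerN subr_eq0 horner_sum.
    rewrite (big_rem z) //= hornerZ mulfVK // big_seq big1 ?addr0 // => x.
    rewrite mem_rem_uniq // !inE => /andP[xz xs_x].
    by rewrite hornerZ (Lx x z) ?mulr0 // eq_sym.
  apply: (leq_trans (size_polyD _ _)); rewrite geq_max szf size_polyN.
  rewrite /g big_seq; elim/big_ind: _ => [|p q hp hq|x xs_x].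
  - by rewrite size_poly0.
  - by apply: (leq_trans (size_polyD _ _)); rewrite geq_max; apply/andP.
  - by apply: (leq_trans (size_scale_leq _ _)); rewrite szL.
rewrite {2}fg coef_sum big_seq [RHS]big_seq; apply: eq_bigr => x xs_x.
rewrite -LD coefZ -(szL x xs_x) -[_`_ _.-1]/(lead_coef (L x)).
by rewrite LE // (monicP (monic_prod_XsubC _ _ _)) mulr1.
Qed.

Section Nodes.
Variables (F : fieldType) (s t : seq nat) (X Y : nat -> F).
Hypotheses (Us : uniq s) (Xinj : {in s &, injective X})
  (st : size s = (size t).+1).

Let f : {poly F} := \prod_(y <- map Y t) ('X - y%:P).

Let szf : size f = size s.
Proof. by rewrite size_prod_XsubC size_map st. Qed.

Let fE x : f.[x] = \prod_(j <- t) (x - Y j).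
Proof.
by rewrite horner_prod big_map; apply: eq_bigr => j _; rewrite hornerXsubC.
Qed.

Let den p : p \in s ->
  \prod_(y <- map X s | y != X p) (X p - y) =
  \prod_(j <- s | j != p) (X p - X j).
Proof.
move=> sp; rewrite big_map big_seq_cond [RHS]big_seq_cond.
apply: eq_bigl => j; case sj: (j \in s) => //=.
by congr negb; apply/eqP/eqP => [/Xinj->|->].
Qed.

Lemma sum_nodes :
  \sum_(p <- s) \prod_(j <- t) (X p - Y j) /
                \prod_(j <- s | j != p) (X p - X j) = 1.
Proof.
have := @lagrange_lead _ (map X s) f; rewrite map_inj_in_uniq // size_map szf.
move=> /(_ Us (leqnn _)); rewrite big_map -szf -[f`_ _]/(lead_coef f).
rewrite (monicP (monic_prod_XsubC _ _ _)) => E.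
rewrite -[RHS]E big_seq [RHS]big_seq; apply: eq_bigr => p sp; rewrite fE den;
  [reflexivity|exact: sp].
Qed.

(* Lagrange interpolation with [0] as an additional node. *)
Lemma sum_nodes_inv : {in s, forall p, X p != 0} ->
  \sum_(p <- s) (X p)^-1 * (\prod_(j <- t) (X p - Y j) /
                \prod_(j <- s | j != p) (X p - X j)) =
  \prod_(j <- t) Y j / \prod_(j <- s) X j.
Proof.
move=> X0; have sX0 : 0 \notin map X s.
  by apply/mapP => -[p sp /esym/eqP]; apply/negP; apply: X0.
have := @lagrange_lead _ (0 :: map X s) f.
rewrite /= map_inj_in_uniq // sX0 Us size_map szf => /(_ isT (leqnSn _)).
rewrite [f`_ _]nth_default ?szf // !big_cons eqxx fE /= => /eqP.
rewrite addr_eq0 => /eqP E.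
transitivity (\sum_(p <- s) f.[X p] /
    \prod_(y <- 0 :: map X s | y != X p) (X p - y)).
  rewrite big_seq [RHS]big_seq; apply: eq_bigr => p sp; rewrite fE.
  by rewrite big_cons eq_sym X0 // subr0 den // invfM mulrCA.
rewrite [X in _ = - X]big_map in E; rewrite -[LHS]opprK -E.
have -> : \prod_(y <- map X s | y != 0) (0 - y) = \prod_(j <- s) - X j.
  rewrite big_map big_seq_cond [RHS]big_seq; apply: eq_big => [p|p _].
    by case sp: (p \in s); rewrite //= X0.
  by rewrite sub0r.
have prodN (r : seq nat) (h : nat -> F) :
    \prod_(j <- r) - h j = (-1) ^+ size r * \prod_(j <- r) h j.
  elim: r => [|j r IH]; first by rewrite !big_nil mul1r.
  by rewrite !big_cons IH /= exprS; ring.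
rewrite (eq_bigr (fun j => - Y j)) => [|j _]; last by rewrite sub0r.
have pX : \prod_(j <- s) X j != 0.
  by rewrite prodf_seq_neq0; apply/allP => p sp; rewrite /= X0.
have e0 : (-1) ^+ size t != 0 :> F by rewrite signr_eq0.
by rewrite !prodN st exprS; field; rewrite pX e0 oppr_eq0 oner_eq0.
Qed.

Lemma node_term p : p \in s -> X p != 0 ->
  \prod_(j <- t) (1 - Y j / X p) / \prod_(j <- s | j != p) (1 - X j / X p) =
  \prod_(j <- t) (X p - Y j) / \prod_(j <- s | j != p) (X p - X j).
Proof.
move=> sp Xp0.
have factor (r : seq nat) (Z : nat -> F) :
    \prod_(j <- r) (X p - Z j) = X p ^+ size r * \prod_(j <- r) (1 - Z j / X p).
  elim: r => [|j r IH]; first by rewrite !big_nil mul1r.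
  rewrite !big_cons IH /= exprS mulrACA; congr (_ * _).
  by rewrite mulrBr mulr1 mulrC divfK.
have remE G : \prod_(j <- s | j != p) G j = \prod_(j <- rem p s) G j :> F.
  by rewrite rem_filter // big_filter.
rewrite !remE !factor.
rewrite size_rem // st /= invfM mulrACA divff ?mul1r //.
by rewrite expf_neq0.
Qed.

End Nodes.

Lemma mxrank_pred_mx (F : fieldType) (m : nat) (P : pred 'I_m) :
  \rank (\matrix_(a, b) ((a == b) && P a)%:R : 'M[F]_m) = #|P|.
Proof.
set D := (X in \rank X).
pose Y : 'M[F]_(#|P|, m) := \matrix_(a, b) (enum_val a == b)%:R.
have YYt : Y *m Y^T = 1%:M.
  apply/matrixP => a b; rewrite !mxE (bigD1 (enum_val a)) //= !mxE eqxx mul1r.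
  rewrite big1 ?addr0 => [|k /negPf ka].
    by rewrite (inj_eq enum_val_inj) eq_sym.
  by rewrite !mxE eq_sym ka mul0r.
have YtY : D = Y^T *m Y.
  apply/matrixP => a b; rewrite !mxE.
  case Pa: (P a); last first.
    rewrite andbF big1 // => k _; rewrite !mxE.
    case: eqP => [ka|]; last by rewrite mul0r.
    by have := enum_valP k; rewrite ka unfold_in Pa.
  have aP : a \in P by rewrite unfold_in.
  rewrite andbT (bigD1 (enum_rank_in aP a)) //= !mxE enum_rankK_in // eqxx.
  rewrite mul1r big1 ?addr0 // => k ka; rewrite !mxE.
  case: eqP => [E|]; last by rewrite mul0r.
  by case/eqP: ka; rewrite -[LHS](enum_valK_in aP) E.
apply/eqP; rewrite eqn_leq YtY (leq_trans (mxrankM_maxr _ _)) ?rank_leq_row //=.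
have E : Y = Y *m (Y^T *m Y) by rewrite mulmxA YYt mul1mx.
have rY : \rank Y = #|P|.
  apply/eqP; rewrite eqn_leq rank_leq_row /= -[X in (X <= _)%N](mxrank1 F).
  by rewrite -YYt mxrankM_maxl.
by rewrite -{1}rY {1}E mxrankM_maxr.
Qed.

Lemma mxrank_row_pivot (F : fieldType) (m : nat) (H E : pred 'I_m)
    (pi : 'I_m -> 'I_m) (V B : 'M[F]_m) :
  V \in unitmx -> {in E &, injective pi} ->
  (forall k, E k -> H (pi k)) ->
  (forall k a, ~~ H k -> V a k = (a == k)%:R) ->
  (forall k a, E k -> B a k = V a (pi k)) ->
  (forall k a, ~~ E k -> B a k = 0) ->
  \rank (row_mx (\matrix_(k, k') ((k == k') && ~~ H k)%:R) B)
    = (#|[pred k | ~~ H k]| + #|E|)%N.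
Proof.
move=> Vu pi_inj EH VH VE BE.
pose D (P : pred 'I_m) : 'M[F]_m := \matrix_(a, b) ((a == b) && P a)%:R.
pose D2 : 'M[F]_m := \matrix_(a, b) ((a == pi b) && E b)%:R.
pose P : pred 'I_m := [predU [pred k | ~~ H k] & [seq pi x | x in E]].
have -> : row_mx (\matrix_(k, k') ((k == k') && ~~ H k)%:R) B
    = V *m row_mx (D [pred k | ~~ H k]) D2.
  rewrite mul_mx_row; congr row_mx; apply/matrixP => a b; rewrite !mxE.
    rewrite (bigD1 b) //= big1 ?addr0 => [|k kb]; rewrite !mxE; last first.
      by rewrite (negPf kb) mulr0.
    rewrite eqxx /=; case Hb: (H b); rewrite /= ?mulr0.
      by case: eqP => [->|]; rewrite ?Hb.
    by rewrite mulr1 VH ?Hb //; case: eqP => [->|]; rewrite ?Hb.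
  rewrite (bigD1 (pi b)) //= big1 ?addr0 => [|k kb]; rewrite !mxE; last first.
    by rewrite (negPf kb) mulr0.
  rewrite eqxx /=; case Eb: (E b); first by rewrite mulr1 VE.
  by rewrite mulr0 BE ?Eb.
set X := row_mx _ _.
rewrite (eqmxMfull X) ?row_full_unit //.
have DX : D P *m X = X.
  rewrite mul_mx_row; congr row_mx; apply/matrixP => a b; rewrite !mxE.
    rewrite (bigD1 a) //= big1 ?addr0 => [|k kb]; rewrite !mxE; last first.
      by rewrite eq_sym (negPf kb) mul0r.
    rewrite eqxx /= /P /= inE; case Ha: (H a); first by rewrite andbF mulr0.
    by rewrite mul1r.
  rewrite (bigD1 a) //= big1 ?addr0 => [|k kb]; rewrite !mxE; last first.
    by rewrite eq_sym (negPf kb) mul0r.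
  rewrite eqxx /=; case: eqP => [->|]; last by rewrite mulr0.
  case Eb: (E b); last by rewrite mulr0.
  by rewrite /P /= !inE fintype.image_f ?orbT ?mulr1.
have XD : X *m col_mx (D [pred k | ~~ H k]) D2^T = D P.
  rewrite mul_row_col; apply/matrixP => a b; rewrite !mxE.
  rewrite (bigD1 a) //= big1 ?addr0 => [|k kb]; rewrite !mxE; last first.
    by rewrite eq_sym (negPf kb) mul0r.
  rewrite eqxx /=; case imE: (a \in [seq pi x | x in E]); last first.
    rewrite big1 ?addr0 => [|k _]; rewrite ?mxE.
      rewrite /P /= !inE imE orbF; case: (H a); rewrite ?andbF ?mul0r //.
      by rewrite andbT mul1r.
    case: eqP => [ak|]; rewrite ?mul0r //.
    case Ek: (E k); rewrite ?mul0r //.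
    by move: imE; rewrite ak fintype.image_f.
  rewrite /P /= !inE imE orbT andbT.
  have /fintype.imageP[k0 Ek0 ak0] := imE.
  have Ha : H a by rewrite ak0 EH.
  rewrite Ha mul0r add0r (bigD1 k0) //= !mxE -ak0 eqxx.
  rewrite unfold_in in Ek0; rewrite Ek0 !andbT mul1r eq_sym.
  rewrite big1 ?addr0 // => k kk0; rewrite !mxE.
  case: eqP => [ak|]; rewrite ?mul0r //.
  case Ek: (E k); rewrite ?mul0r //.
  by move: kk0; rewrite (pi_inj k k0) ?eqxx ?unfold_in -?ak -?ak0.
have -> : \rank X = \rank (D P).
  apply/eqP; rewrite eqn_leq -{1}DX mxrankM_maxl /=.
  by rewrite -{1}XD mxrankM_maxl.
rewrite mxrank_pred_mx.
have disj : [predI [pred k | ~~ H k] & [seq pi x | x in E]] =i pred0.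
  move=> a; rewrite !inE; apply/andP => -[/negP Ha /fintype.imageP[k Ek ak]].
  by apply: Ha; rewrite ak EH.
rewrite -(card_in_image pi_inj) -cardUI (eq_card disj) card0 addn0.
by apply: eq_card.
Qed.

(** * Independence of the torus weights *)

Section Weights.
Variables (R : realType) (n : nat).
Hypothesis hn : (2 <= n)%N.

Local Notation F := (Ffield R n).
Local Notation t := (tvar R n).
Local Notation v := (vv R n).

Definition monoF (e : nat -> nat) : F :=
  @FracField.tofrac (mpoly.mpoly n R[i])
    (mpoly.mpolyX _ [multinom e (nat_of_ord k) | k < n]).

Lemma monoF_inj e e' : monoF e = monoF e' -> forall k, (k < n)%N -> e k = e' k.
Proof.
move=> /eqP; rewrite tofrac_eq => /eqP E k kn.
have := congr1 (mpoly.mcoeff [multinom e (nat_of_ord k) | k < n]) E.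
rewrite !mpoly.mcoeffX eqxx; case: eqP => [/mnmP/(_ (Ordinal kn))|_ /eqP].
  by rewrite !mnmE.
by rewrite oner_eq0.
Qed.

Lemma eq_monoF e e' : e =1 e' -> monoF e = monoF e'.
Proof.
move=> E; congr (FracField.tofrac (mpoly.mpolyX _ _)).
by apply/mnmP => a; rewrite !mnmE.
Qed.

Lemma monoF1 e : e =1 (fun=> 0%N) -> monoF e = 1.
Proof.
move=> E; rewrite /monoF -tofrac1 -mpolyX0.
by congr (FracField.tofrac (mpoly.mpolyX _ _)); apply/mnmP => a; rewrite !mnmE.
Qed.

Lemma monoFM e e' : monoF e * monoF e' = monoF (fun k => e k + e' k)%N.
Proof.
rewrite /monoF -tofracM -mpolyXD; congr (FracField.tofrac (mpoly.mpolyX _ _)).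
by apply/mnmP => k; rewrite mnmDE !mnmE.
Qed.

Lemma monoF_neq0 e : monoF e != 0.
Proof.
rewrite tofrac_eq0; apply/eqP => /(congr1 (mpoly.mcoeff
  [multinom e (nat_of_ord k) | k < n])).
by rewrite mpoly.mcoeffX mpoly.mcoeff0 eqxx => /eqP; rewrite oner_eq0.
Qed.

Lemma monoFX e k : monoF e ^+ k = monoF (fun a => e a * k)%N.
Proof.
elim: k => [|k IH]; first by rewrite expr0 monoF1 // => a; rewrite muln0.
by rewrite exprS IH monoFM; apply: eq_monoF => a; rewrite mulnS.
Qed.

Lemma Fvar_monoF k : (k < n)%N -> Fvar R n k = monoF (fun a => k == a).
Proof.
move=> kn; rewrite /Fvar (insubT (fun a => a < n)%N kn).
by congr (FracField.tofrac (mpoly.mpolyX _ _)); apply/mnmP => a; rewrite mnmE.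
Qed.

Lemma vv_monoF : v = monoF (fun a => n.-1 == a).
Proof. by rewrite /vv Fvar_monoF //; lia. Qed.

Lemma tvar_monoF l : (0 < l <= n)%N ->
  t l = monoF (fun a => (l < n) && (l.-1 == a))%N /
        monoF (fun a => (l == n) && (a < n.-1))%N.
Proof.
move=> ln; rewrite /tvar; have [->|l_n] := eqVneq l n.
  rewrite [X in X / _]monoF1 ?ltnn // mul1r; congr (_^-1) => /=.
  suff H m : (m <= n.-1)%N ->
      \prod_(0 <= j < m) Fvar R n j = monoF (fun a => a < m)%N by rewrite H.
  elim: m => [_|m IH mn]; first by rewrite big_geq // monoF1.
  rewrite big_nat_recr //= IH; last by lia.
  rewrite Fvar_monoF ?monoFM; last by lia.
  by apply: eq_monoF => a; lia.
rewrite Fvar_monoF; last by lia.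
rewrite [X in _ / X]monoF1 // divr1; apply: eq_monoF => a.
by lia.
Qed.

Lemma vv_neq0 : v != 0.
Proof. by rewrite vv_monoF monoF_neq0. Qed.

Lemma tvar_neq0 l : (0 < l <= n)%N -> t l != 0.
Proof.
by move=> ln; rewrite tvar_monoF // mulf_neq0 ?invr_neq0 ?monoF_neq0.
Qed.

Lemma weights_indep j l (a b : nat) : (0 < j <= n)%N -> (0 < l <= n)%N ->
  t l ^+ 2 * v ^+ a = t j ^+ 2 * v ^+ b -> (j = l) /\ (a = b).
Proof.
move=> jn ln; rewrite !tvar_monoF // vv_monoF !expr_div_n => /eqP.
rewrite ![_ / _ * _]mulrAC eqr_div ?expf_neq0 ?monoF_neq0 //.
rewrite !(monoFX, monoFM) => /eqP/monoF_inj H.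
have [jl|jl] := eqVneq j l.
  split=> //; move: (H n.-1); rewrite jl eqxx ltnn !andbF !mul1n !addn0.
  by move=> E; apply/(@addnI ((l < n) && (l.-1 == n.-1) * 2)%N)/E; lia.
exfalso; have [l_n|l_n] := ltnP l n.
  move: (H l.-1); rewrite l_n eqxx.
  have -> : (n.-1 == l.-1) = false by apply/eqP; lia.
  have -> : (j.-1 == l.-1) = false by apply/eqP; lia.
  have -> : (l == n) = false by apply/eqP; lia.
  by rewrite !andbF /= !mul0n => E; have := E (leq_ltn_trans (leq_pred _) l_n).
have j_n : (j < n)%N by lia.
move: (H j.-1); rewrite j_n eqxx.
have -> : (n.-1 == j.-1) = false by apply/eqP; lia.
have -> : (l < n)%N = false by apply/negbTE; lia.
have -> : (j == n) = false by apply/eqP; lia.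
by rewrite /= !mul0n => E; have := E (leq_ltn_trans (leq_pred _) j_n).
Qed.

End Weights.

Section WeightFactor.
Variables (F : fieldType) (n : nat) (t : nat -> F) (v : F).

Definition weight_factor (j l : nat) (e : int) : F :=
  1 - t l ^+ 2 * t j ^- 2 * v ^ (- (2 * e)).

Definition generic_params : Prop :=
  [/\ v != 0, forall l, (0 < l <= n)%N -> t l != 0 &
    forall j l (a b : nat), (0 < j <= n)%N -> (0 < l <= n)%N ->
      t l ^+ 2 * v ^+ a = t j ^+ 2 * v ^+ b -> j = l /\ a = b].

Lemma weight_factor_eq0 j l e : generic_params ->
  (0 < j <= n)%N -> (0 < l <= n)%N ->
  (weight_factor j l e == 0) = (j == l) && (e == 0).
Proof.
case=> v0 t0 indep jn ln; rewrite /weight_factor subr_eq0 eq_sym.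
have tj := expf_neq0 2 (t0 j jn).
apply/eqP/andP => [|[/eqP<- /eqP->]]; last first.
  by rewrite mulr0 oppr0 expr0z mulr1 divff.
case: e => e E.
  have ve := expf_neq0 (2 * e) v0.
  move: E; have -> : - (2 * e%:Z) = - (2 * e)%N%:Z by lia.
  rewrite -exprnN => E.
  suff [->] : j = l /\ 0%N = (2 * e)%N by lia.
  apply: indep => //.
  by rewrite expr0 mulr1 -[RHS]mul1r -E; field; rewrite ve (t0 j jn).
move: E; have -> : - (2 * Negz e) = (2 * e.+1)%N%:Z by lia.
rewrite -exprnP => E.
suff [->] : j = l /\ (2 * e.+1)%N = 0%N by lia.
apply: indep => //.
by rewrite expr0 mulr1 -[RHS]mul1r -E; field; rewrite (t0 j jn).
Qed.

End WeightFactor.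

Lemma generic_Ffield (R : realType) (n : nat) : (2 <= n)%N ->
  generic_params n (@tvar R n) (vv R n).
Proof.
by move=> hn; split; [exact: vv_neq0 | exact: tvar_neq0 | exact: weights_indep].
Qed.

(** * Tangent spaces at the fixed points *)

Definition subsheaf (S T : msheaf) : bool :=
  (rk S <= rk T)%N && all (fun j => vord T j <= vord S j)%N (iota 1 (rk S)).

Lemma subsheafP S T :
  reflect ((rk S <= rk T)%N /\
           forall j, (0 < j <= rk S)%N -> (vord T j <= vord S j)%N)
          (subsheaf S T).
Proof.
apply: (iffP andP) => -[rST /= vST]; split => //.
  by move=> j jS; apply: (allP vST); rewrite mem_iota; lia.
by apply/allP => j; rewrite mem_iota => jS; apply: vST; lia.
Qed.

Lemma has_hom_src S T j l e : subsheaf S T -> (0 < l)%N -> e < 0 ->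
  has_hom S T j l e -> has_hom S S j l e.
Proof.
case/subsheafP => rST vST l0 e0 /and3P[jS ve h]; apply/and3P; split=> //.
case: ifP => // lS; move: h; rewrite (leq_trans lS rST).
by have := vST l; rewrite l0 lS => /(_ isT); lia.
Qed.

Lemma has_hom_tgt S T j l e : subsheaf S T -> (0 < j)%N -> 0 <= e ->
  has_hom S T j l e -> has_hom T T j l e.
Proof.
case/subsheafP => rST vST j0 e0 /and3P[jS ve h]; apply/and3P.
have := vST j; rewrite j0 jS => /(_ isT) vj.
split; [exact: leq_trans rST | by lia |].
by move: h; case: ifP => lT; lia.
Qed.

Definition edge (ch : seq msheaf) j l e (k : nat) : bool :=
  (k.+1 < size ch)%N && has_hom (nthS ch k) (nthS ch k.+1) j l e.

Definition node (ch : seq msheaf) j l e (k : nat) : bool :=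
  has_hom (nthS ch k) (nthS ch k) j l e.

(* The pivot of the equation phi_k = phi_{k+1} is phi_k if e < 0 and phi_{k+1}
   if e >= 0; in both cases this unknown is not already zero. *)
Lemma tangent_multE (R : realType) ch j l e :
  sorted subsheaf ch -> (0 < j)%N -> (0 < l)%N ->
  (tangent_mult R ch j l e + #|[pred k : 'I_(size ch) | edge ch j l e k]|)%N =
  #|[pred k : 'I_(size ch) | node ch j l e k]|.
Proof.
move=> ch_sub j0 l0; set m := size ch.
have sub k : (k.+1 < m)%N -> subsheaf (nthS ch k) (nthS ch k.+1).
  by move=> km; exact: (sortedP _ ch_sub).
rewrite /tangent_mult mxrank_ker /tangent_eqs.
set A := (X in row_mx X _); set B := (X in row_mx _ X).
suff -> : \rank (row_mx A B) =
    (#|[pred k : 'I_m | ~~ node ch j l e k]| +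
     #|[pred k : 'I_m | edge ch j l e k]|)%N.
  set a := #|_|; set b := #|_|; set c := #|_|.
  have mE : (a + c = m)%N.
    rewrite -[RHS](card_ord m) -(cardC [pred k : 'I_m | node ch j l e k]) addnC.
    by congr addn; apply: eq_card => k; rewrite !inE.
  have : (a + b <= m)%N.
    rewrite -mE leq_add2l; case: (ltP e 0) => e0.
      apply: subset_leq_card; apply/fintype.subsetP => k; rewrite !inE.
      by case/andP => km; apply: has_hom_src => //; apply: sub.
    pose f (k : 'I_m) : 'I_m := insubd k k.+1.
    have fE (k : 'I_m) : edge ch j l e k -> f k = k.+1 :> nat.
      by case/andP => km _; rewrite /f val_insubd km.
    rewrite /b -(@card_in_image _ _ f) =>
      [|k k' /fE Ek /fE Ek' /(congr1 val)/=].
      apply: subset_leq_card;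
        apply/fintype.subsetP => _ /fintype.imageP[k Ek ->].
      rewrite inE /= in Ek; rewrite inE fE //.
      by case/andP: Ek => km; apply: has_hom_tgt => //; apply: sub.
    by rewrite Ek Ek' => -[/val_inj].
  rewrite -/m -mE; lia.
case: (ltP e 0) => e0.
  pose V : 'M[R[i]]_m := \matrix_(a, k) ((a == k)%:R -
    (if edge ch j l e k then (a == k.+1 :> nat)%:R else 0)).
  apply: (@mxrank_row_pivot _ _ (node ch j l e) (edge ch j l e) id V).
  - rewrite unitmxE det_trig.
      rewrite big1 ?unitr1 // => k _; rewrite mxE eqxx.
      by rewrite ltn_eqF // if_same subr0.
    apply/is_trig_mxP => a k ak; rewrite mxE -val_eqE /= ltn_eqF // sub0r.
    by case: ifP; rewrite ?oppr0 // ltn_eqF ?oppr0 // ltnS ltnW.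
  - by [].
  - by move=> k /andP[km]; apply: has_hom_src => //; apply: sub.
  - move=> k a nk; rewrite mxE ifF ?subr0 //; apply/negP => /andP[km].
    by move/(has_hom_src (sub _ km) l0 e0); apply/negP.
  - by move=> k a Ek; rewrite !mxE Ek; move: Ek; rewrite /edge => ->.
  - by move=> k a /negPf Ek; rewrite !mxE; move: Ek; rewrite /edge => ->.
pose f (k : 'I_m) : 'I_m := insubd k k.+1.
have fE (k : 'I_m) : edge ch j l e k -> f k = k.+1 :> nat.
  by case/andP => km _; rewrite /f val_insubd km.
pose V : 'M[R[i]]_m := \matrix_(a, k)
  (if (0 < k)%N && edge ch j l e k.-1
   then (a == k.-1 :> nat)%:R - (a == k)%:R else (a == k)%:R).
apply: (@mxrank_row_pivot _ _ (node ch j l e) (edge ch j l e) f V).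
- rewrite -unitmx_tr unitmxE det_trig.
    rewrite unitfE; apply/prodf_neq0 => k _; rewrite !mxE eqxx.
    case: ifP => [/andP[k0 _]|_]; last exact: oner_neq0.
    have -> : (k == k.-1 :> nat) = false by apply/eqP; lia.
    by rewrite sub0r oppr_eq0 oner_neq0.
  apply/is_trig_mxP => a k ak; rewrite !mxE.
  have -> : (k == a) = false by apply/eqP => E; move: ak; rewrite E ltnn.
  case: ifP => [/andP[a0 _]|_]; last by [].
  have -> : (k == a.-1 :> nat) = false by apply/eqP; lia.
  by rewrite subr0.
- by move=> k k' /fE Ek /fE Ek' /(congr1 val)/=; rewrite Ek Ek' => -[/val_inj].
- move=> k Ek; rewrite /= fE //; case/andP: Ek => km.
  by apply: has_hom_tgt => //; apply: sub.
- move=> k a nk; rewrite mxE ifF //; apply/negP => /andP[k0 /andP[km]].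
  move=> h; have := sub _ km; rewrite prednK // => s.
  move: h; rewrite prednK //; move/(has_hom_tgt s j0 e0).
  by apply/negP.
- move=> k a Ek; rewrite !mxE fE //= Ek.
  have fk := fE k Ek; move: Ek; rewrite /edge => ->.
  by rewrite -[a == f k]val_eqE /= fk.
- by move=> k a /negPf Ek; rewrite !mxE; move: Ek; rewrite /edge => ->.
Qed.

Section Schi.
Variables (F : fieldType) (n : nat).

Fixpoint chain_prod (g : msheaf -> msheaf -> F) (S : msheaf) (s : seq msheaf)
    : F :=
  if s is T :: s' then g S T * chain_prod g T s' else 1.

Lemma chain_prod_cat g S s1 s2 :
  chain_prod g S (s1 ++ s2) = chain_prod g S s1 * chain_prod g (last S s1) s2.
Proof. by elim: s1 S => [|T s1 IH] S /=; rewrite ?mul1r // IH mulrA. Qed.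

Lemma chain_prod_prod (r : seq nat) (g : nat -> msheaf -> msheaf -> F) S s :
  chain_prod (fun S T => \prod_(i <- r) g i S T) S s =
  \prod_(i <- r) chain_prod (g i) S s.
Proof.
elim: s S => [|T s IH] S /=; first by rewrite big1.
by rewrite IH big_split.
Qed.

Lemma eq_chain_prod (P : pred msheaf) (g h : msheaf -> msheaf -> F) S s :
  (forall S T, P S -> P T -> g S T = h S T) -> all P (S :: s) ->
  chain_prod g S s = chain_prod h S s.
Proof.
move=> gh; elim: s S => [|T s IH] S //= /and3P[PS PT Ps].
by rewrite gh // IH //= PT.
Qed.

Lemma chain_prod_edge (w : F) j l e (S : msheaf) (ch : seq msheaf) :
  w ^+ #|[pred k : 'I_(size (S :: ch)) | edge (S :: ch) j l e k]| =
  chain_prod (fun S T => if has_hom S T j l e then w else 1) S ch.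
Proof.
rewrite -prodr_const big_mkcond /=.
rewrite -(big_mkord xpredT (fun k => if edge (S :: ch) j l e k then w else 1)).
elim: ch S => [|T ch IH] S /=; first by rewrite big_nat1.
rewrite big_nat_recl // -IH /=; congr (_ * _).
Qed.

Lemma prod_node (w : F) j l e (ch : seq msheaf) :
  w ^+ #|[pred k : 'I_(size ch) | node ch j l e k]| =
  \prod_(S <- ch) (if has_hom S S j l e then w else 1).
Proof.
rewrite -prodr_const big_mkcond /= [RHS](big_nth (MSheaf 0 (fun _ => 0%N))).
by rewrite big_mkord.
Qed.

Variables (t : nat -> F) (v : F).
Hypothesis gen : generic_params n t v.

Local Notation w := (weight_factor t v).

Definition schi (R : realType) (ch : seq msheaf) : F :=
  \prod_(1 <= j < n.+1) \prod_(1 <= l < n.+1)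
  \prod_(0 <= c < height n ch + height n ch)
    let e : int := c%:Z - (height n ch)%:Z in
    w j l e ^- tangent_mult R ch j l e.

Lemma has_hom_weight0 S T j l e : subsheaf S T -> (0 < j <= n)%N ->
  (0 < l <= n)%N -> has_hom S T j l e -> w j l e != 0.
Proof.
move=> /subsheafP[rST vST] jn ln; rewrite (weight_factor_eq0 _ gen jn ln).
apply: contraL => /andP[/eqP<- /eqP->]; apply/negP => /and3P[jS _].
have /vST vj: (0 < j <= rk S)%N by case/andP: jn => ->.
by rewrite (leq_trans jS rST) addr0 ltz_nat ltnNge vj.
Qed.

Lemma tangent_factor (R : realType) S ch j l e :
  path subsheaf S ch -> (0 < j <= n)%N -> (0 < l <= n)%N ->
  w j l e ^- tangent_mult R (S :: ch) j l e =
  chain_prod (fun S T => if has_hom S T j l e then w j l e else 1) S ch /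
  \prod_(T <- S :: ch) (if has_hom T T j l e then w j l e else 1).
Proof.
move=> ch_sub jn ln.
rewrite -chain_prod_edge -prod_node -(@tangent_multE R) //; last 2 first.
- by case/andP: jn.
- by case/andP: ln.
set b := #|_|; rewrite addnC exprD invfM mulrA.
have [w0|w0] := eqVneq (w j l e) 0; last by rewrite divff ?mul1r // expf_neq0.
suff -> : b = 0%N by rewrite expr0 divr1 mul1r.
  apply/eqP; rewrite -leqn0 -[X in (_ <= X)%N](card0 'I_(size (S :: ch))).
  apply/subset_leq_card/fintype.subsetP => k; rewrite !inE => /andP[km h].
  have sub : subsheaf (nthS (S :: ch) k) (nthS (S :: ch) k.+1).
    by apply: (sortedP _ (ch_sub : sorted subsheaf (S :: ch))).
  by move: (has_hom_weight0 sub jn ln h); rewrite w0 eqxx.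
Qed.

Definition hom_prod (S T : msheaf) : F :=
  \prod_(1 <= j < (rk S).+1) \prod_(1 <= l < n.+1)
  \prod_(0 <= c < if (l <= rk T)%N then vord T l else vord S j)
    w j l (c%:Z - (vord S j)%:Z).

Lemma prod_window (N a L : nat) (P : int -> bool) (f : int -> F) :
  (a <= N)%N -> (L <= N)%N ->
  (forall c : nat, P (c%:Z - N%:Z) = (N <= c + a < N + L)%N) ->
  \prod_(0 <= c < N + N) (if P (c%:Z - N%:Z) then f (c%:Z - N%:Z) else 1) =
  \prod_(0 <= c < L) f (c%:Z - a%:Z).
Proof.
move=> aN LN PE.
rewrite (@big_cat_nat _ _ _ (N - a)) //=; last by lia.
rewrite (@big_cat_nat _ _ _ (N - a + L) (N - a)) //=; [|by lia|by lia].
rewrite big_nat big1 ?mul1r => [|c cN]; last by rewrite PE ifF //; lia.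
rewrite mulrC big_nat big1 ?mul1r => [|c cN]; last by rewrite PE ifF //; lia.
rewrite -{1}[(N - a)%N]add0n big_addn addKn big_nat [RHS]big_nat.
apply: eq_bigr => c cL; rewrite PE ifT; last by lia.
by congr f; lia.
Qed.

Lemma hom_prodE (N : nat) S T : (rk S <= n)%N ->
  (forall j, (0 < j <= n)%N -> (vord S j <= N)%N && (vord T j <= N)%N) ->
  \prod_(1 <= j < n.+1) \prod_(1 <= l < n.+1)
    \prod_(0 <= c < N + N)
      (if has_hom S T j l (c%:Z - N%:Z) then w j l (c%:Z - N%:Z) else 1) =
  hom_prod S T.
Proof.
move=> Sn SN; rewrite (@big_cat_nat _ _ _ (rk S).+1) //=.
rewrite mulrC big_nat big1 ?mul1r => [|j jS]; last first.
  rewrite big1 // => l _; rewrite big1 // => c _.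
  by rewrite /has_hom leqNgt (andP jS).1.
rewrite big_nat [RHS]big_nat; apply: eq_bigr => j jS.
rewrite big_nat [RHS]big_nat; apply: eq_bigr => l ln.
have /andP[Sj _] : (vord S j <= N)%N && (vord T j <= N)%N by apply: SN; lia.
have /andP[_ Tl] : (vord S l <= N)%N && (vord T l <= N)%N by apply: SN; lia.
have jS' : (j <= rk S)%N by lia.
by apply: prod_window => // [|c]; rewrite /has_hom ?jS' /=; case: ifP; lia.
Qed.

Definition vord_le (N : nat) (S : msheaf) : bool :=
  all (fun j => vord S j <= N)%N (iota 1 n).

Lemma vord_leP N S :
  reflect (forall j, (0 < j <= n)%N -> (vord S j <= N)%N) (vord_le N S).
Proof.
apply: (iffP allP) => vS j => [jn|]; first by apply: vS; rewrite mem_iota; lia.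
by rewrite mem_iota => jn; apply: vS; lia.
Qed.

Lemma vord_le_height ch : all (vord_le (height n ch)) ch.
Proof.
elim: ch => //= S ch IH; rewrite /height big_cons; apply/andP; split.
  apply/vord_leP => j jn; apply: (leq_trans _ (leq_maxl _ _)).
  by apply: (leq_bigmax_seq j); rewrite ?mem_index_iota; lia.
apply: sub_all IH => T /vord_leP vT; apply/vord_leP => j jn.
exact: leq_trans (vT j jn) (leq_maxr _ _).
Qed.

Lemma schiE (R : realType) S ch :
  path subsheaf S ch -> all (fun T => rk T <= n)%N (S :: ch) ->
  schi R (S :: ch) =
  chain_prod hom_prod S ch / \prod_(T <- S :: ch) hom_prod T T.
Proof.
move=> ch_sub ch_rk; have ch_v := vord_le_height (S :: ch).
set N := height n (S :: ch) in ch_v.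
pose P T := (rk T <= n)%N && vord_le N T.
have ch_P : all P (S :: ch).
  elim: (S :: ch) ch_rk ch_v => //= T s IH /andP[rT rs] /andP[vT vs].
  by rewrite /P rT vT IH.
pose g j l (c : nat) (S T : msheaf) : F :=
  if has_hom S T j l (c%:Z - N%:Z) then w j l (c%:Z - N%:Z) else 1.
have gE T T' : P T -> P T' -> hom_prod T T' = \prod_(1 <= j < n.+1)
    \prod_(1 <= l < n.+1) \prod_(0 <= c < N + N) g j l c T T'.
  move=> /andP[rT /vord_leP vT] /andP[_ /vord_leP vT'].
  by rewrite (hom_prodE (N := N)) // => j jn; rewrite vT // vT'.
rewrite (eq_chain_prod gE ch_P) chain_prod_prod.
have -> : \prod_(T <- S :: ch) hom_prod T T = \prod_(1 <= j < n.+1)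
    \prod_(1 <= l < n.+1) \prod_(0 <= c < N + N)
      \prod_(T <- S :: ch) g j l c T T.
  transitivity (\prod_(T <- S :: ch) \prod_(1 <= j < n.+1)
    \prod_(1 <= l < n.+1) \prod_(0 <= c < N + N) g j l c T T).
    by elim: (S :: ch) ch_P => [|T s IH] /=; rewrite ?big_nil // !big_cons
       => /andP[PT Ps]; rewrite IH // gE.
  rewrite exchange_big; apply: eq_bigr => j _.
  rewrite exchange_big; apply: eq_bigr => l _.
  by rewrite exchange_big.
rewrite -prodf_div /schi -/N big_nat [RHS]big_nat; apply: eq_bigr => j jn.
rewrite chain_prod_prod -prodf_div big_nat [RHS]big_nat.
apply: eq_bigr => l ln; rewrite chain_prod_prod -prodf_div.
by apply: eq_bigr => c _; rewrite tangent_factor.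
Qed.

Lemma hom_prod_neq0 S T : subsheaf S T -> (rk T <= n)%N -> hom_prod S T != 0.
Proof.
move=> /subsheafP[rST vST] Tn; rewrite prodf_seq_neq0; apply/allP => j.
rewrite mem_index_iota => jS /=; rewrite prodf_seq_neq0; apply/allP => l.
rewrite mem_index_iota => ln /=; rewrite prodf_seq_neq0; apply/allP => c.
rewrite mem_index_iota /= => cL.
rewrite (weight_factor_eq0 _ gen); [|by lia|by lia].
apply/andP => -[/eqP jl /eqP]; subst l.
have := vST j; move: cL; rewrite (leq_trans _ rST); last by lia.
by move=> cL /(_ jS); lia.
Qed.

Lemma hom_prod_incr S T T' p : (rk T <= n)%N -> rk T' = rk T ->
  (0 < p <= rk T)%N ->
  (forall l, (0 < l <= rk T)%N -> vord T' l = (vord T l + (l == p))%N) ->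
  hom_prod S T' = hom_prod S T *
    \prod_(1 <= j < (rk S).+1) w j p ((vord T p)%:Z - (vord S j)%:Z).
Proof.
move=> Tn rT pT vT; rewrite /hom_prod -big_split; apply: eq_bigr => j _ /=.
rewrite (bigD1_seq p) ?iota_uniq ?mem_index_iota //=; last by lia.
rewrite [in RHS](bigD1_seq p) ?iota_uniq ?mem_index_iota //=; last by lia.
rewrite rT; case/andP: (pT) => p0 ->; rewrite vT // eqxx addn1.
rewrite big_nat_recr //= mulrAC; congr (_ * _ * _).
rewrite big_seq_cond [RHS]big_seq_cond; apply: eq_bigr => l /andP[].
rewrite mem_index_iota => ln lp; case: ifP => // lT.
have lT0 : (0 < l <= rk T)%N by lia.
by rewrite vT // (negPf lp) addn0.
Qed.

End Schi.

(** * Adding and removing boxes *)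

Section Degrees.
Variable n : nat.
Implicit Types (d : degree n) (i k : nat).

Lemma dg_out d k : (n <= k)%N -> dg d k = 0%N.
Proof.
move=> nk; rewrite /dg; case: k nk => [|k] nk //=.
by rewrite nth_default // size_tuple; lia.
Qed.

Lemma dg_tnth d (k : 'I_n.-1) : dg d k.+1 = tnth d k.
Proof. by rewrite (tnth_nth 0%N). Qed.

Lemma dg_inj d d' :
  (forall k, (0 < k < n)%N -> dg d k = dg d' k) -> d = d'.
Proof.
move=> E; apply: eq_from_tnth => k; rewrite -!dg_tnth E //.
by have := ltn_ord k; lia.
Qed.

Lemma dg_incr d i k : (0 < i < n)%N -> dg (incr d i) k = (dg d k + (k == i))%N.
Proof.
move=> iN; have [nk|kn] := leqP n k.
  by rewrite !dg_out // gtn_eqF //; lia.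
case: k kn => [|k] kn; first by rewrite /dg /= ltn_eqF //; lia.
have kn' : (k < n.-1)%N by lia.
by rewrite (dg_tnth (incr d i) (Ordinal kn')) tnth_mktuple -dg_tnth.
Qed.

Lemma incr_inj i : (0 < i < n)%N -> injective (@incr n ^~ i).
Proof.
move=> iN d d' /(congr1 (@dg n)) E; apply: dg_inj => k _.
by have := congr1 (@^~ k) E; rewrite /= !dg_incr // => /addIn.
Qed.

Definition total d : nat := (\sum_(1 <= k < n) dg d k)%N.

Lemma total_incr d i : (0 < i < n)%N -> total (incr d i) = (total d).+1.
Proof.
move=> iN; rewrite /total (eq_bigr (fun k => dg d k + (k == i)))%N => [|k _].
  rewrite big_split /= -[RHS]addn1; congr addn.
  rewrite (bigD1_seq i) ?iota_uniq ?mem_index_iota //= eqxx.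
  by rewrite big1 // => k /negPf->.
by rewrite dg_incr.
Qed.

End Degrees.

Section FixedPoints.
Variable n : nat.
Implicit Types (x y : fixpt n) (i j k p : nat).

Definition column_mono (g : nat -> nat -> nat) : Prop :=
  forall i k j, (0 < j <= k)%N -> (k <= i)%N -> (i < n)%N -> (g i j <= g k j)%N.

Lemma is_fixptP s : reflect (shape s = iota 1 n.-1 /\ column_mono (sent s))
  (is_fixpt n s).
Proof.
apply: (iffP andP) => -[/eqP sh mono]; split=> //.
  move=> i k j jk ki iN.
  have iI : i \in iota 1 n.-1 by rewrite mem_iota; lia.
  have kI : k \in iota 1 i by rewrite mem_iota; lia.
  have jI : j \in iota 1 k by rewrite mem_iota; lia.
  exact: (allP (allP (allP mono i iI) k kI) j jI).
apply/allP => i; rewrite mem_iota => iN; apply/allP => k;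
  rewrite mem_iota => ki.
by apply/allP => j; rewrite mem_iota => jk; apply: mono; lia.
Qed.

Lemma ent_mono x : column_mono (ent x).
Proof. by have /is_fixptP[] := valP x. Qed.

Lemma size_fixpt x : size (val x) = n.-1.
Proof.
have /is_fixptP[/(congr1 size) + _] := valP x.
by rewrite size_map size_iota.
Qed.

Lemma size_row x i : (0 < i < n)%N -> size (nth [::] (val x) i.-1) = i.
Proof.
move=> iN; have /is_fixptP[sh _] := valP x.
have := congr1 (nth 0%N ^~ i.-1) sh.
rewrite /shape (nth_map [::]) ?size_fixpt; last by lia.
by move=> ->; rewrite nth_iota; lia.
Qed.

Lemma ent_out x i j : (0 < i)%N -> (n <= i)%N -> ent x i j = 0%N.
Proof.
move=> i0 ni; rewrite /ent /sent [nth [::] _ _]nth_default ?nth_nil //.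
by rewrite size_fixpt; lia.
Qed.

Lemma fixpt_ext x y :
  (forall i j, (0 < j <= i)%N -> (i < n)%N -> ent x i j = ent y i j) -> x = y.
Proof.
move=> E; apply/val_inj/(@eq_from_nth _ [::]); first by rewrite !size_fixpt.
move=> i; rewrite size_fixpt => iN; apply: (@eq_from_nth _ 0%N).
  by rewrite (@size_row x i.+1) ?(@size_row y i.+1); lia.
move=> j; rewrite (@size_row x i.+1); last by lia.
by move=> ji; apply: (E i.+1 j.+1); lia.
Qed.

Definition mk_fixpt (g : nat -> nat -> nat) : fixpt n :=
  insubd (fixpt0 n) [seq [seq g i j | j <- iota 1 i] | i <- iota 1 n.-1].

Lemma ent_mk_fixpt g i j : column_mono g -> (0 < j <= i)%N -> (i < n)%N ->
  ent (mk_fixpt g) i j = g i j.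
Proof.
move=> mono; pose s := [seq [seq g i j | j <- iota 1 i] | i <- iota 1 n.-1].
have sE a b : (0 < b <= a)%N -> (a < n)%N -> sent s a b = g a b.
  move=> ba aN; rewrite /sent (nth_map 0%N) ?size_iota; last by lia.
  rewrite (nth_map 0%N) ?size_iota ?nth_iota; [|lia..].
  by congr g; lia.
move=> ji iN; rewrite /ent val_insubd ifT ?sE //; apply/is_fixptP; split.
  rewrite /shape -map_comp -[RHS]map_id; apply/eq_map => a /=.
  by rewrite size_map size_iota.
by move=> a c b bc ca aN; rewrite !sE; [apply: mono|lia..].
Qed.

Lemma ent_fixpt0 i j : ent (fixpt0 n) i j = 0%N.
Proof.
rewrite /ent /sent /=; case: (ltnP i.-1 (size (iota 1 n.-1))) => h.
  by rewrite (nth_map 0%N) // nth_nseq if_same.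
by rewrite [nth [::] _ _]nth_default ?size_map // nth_nil.
Qed.

Lemma dg_fdeg x i : dg (fdeg x) i = (\sum_(1 <= j < i.+1) ent x i j)%N.
Proof.
have [ni|iN] := leqP n i.
  rewrite dg_out // big_nat big1 // => j ji.
  by rewrite ent_out //; lia.
case: i iN => [|i] iN; first by rewrite big_geq.
have iN' : (i < n.-1)%N by lia.
by rewrite (dg_tnth (fdeg x) (Ordinal iN')) tnth_mktuple.
Qed.

Lemma fdeg_fixpt0 : fdeg (fixpt0 n) = deg0 n.
Proof.
apply: eq_from_tnth => k; rewrite !tnth_mktuple big1 // => j _.
by rewrite ent_fixpt0.
Qed.

Definition addbox x i p : fixpt n :=
  mk_fixpt (fun a b => ent x a b + ((a == i) && (b == p)))%N.

Definition addable x i p : bool := (p == i) || (ent x i p < ent x i.-1 p)%N.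

Lemma ent_addbox x i p a b : (0 < p <= i)%N -> addable x i p ->
  (0 < b <= a)%N -> (a < n)%N ->
  ent (addbox x i p) a b = (ent x a b + ((a == i) && (b == p)))%N.
Proof.
move=> pi ok ba aN; rewrite ent_mk_fixpt // => {ba aN}a c {}b bc ca aN.
have le_ac := @ent_mono x a c b bc ca aN.
have [ai|ai] := eqVneq a i; last by rewrite addn0; lia.
have [ci|ci] := eqVneq c i; first by rewrite leq_add2r.
have [bp|bp] := eqVneq b p; last by rewrite !andbF !addn0.
subst; case/orP: ok => [/eqP|lt_p]; first by lia.
by have := @ent_mono x i.-1 c p bc; lia.
Qed.

Definition covers i x : seq (fixpt n) :=
  [seq addbox x i p | p <- iota 1 i & addable x i p].

Lemma coversP i x y : reflect (exists p, [/\ (0 < p <= i)%N, addable x i p &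
  y = addbox x i p]) (y \in covers i x).
Proof.
apply: (iffP mapP) => -[p]; rewrite ?mem_filter ?mem_iota.
  by move=> /andP[ok pi] ->; exists p; split=> //; lia.
by case=> pi ok ->; exists p => //; rewrite mem_filter mem_iota ok /=; lia.
Qed.

Lemma addbox_inj x i p q : (i < n)%N -> (0 < p <= i)%N -> (0 < q <= i)%N ->
  addable x i p -> addable x i q -> addbox x i p = addbox x i q -> p = q.
Proof.
move=> iN pi qi okp okq /(congr1 (fun z => ent z i p)).
by rewrite !ent_addbox // !eqxx /=; lia.
Qed.

Lemma covers_uniq i x : (i < n)%N -> uniq (covers i x).
Proof.
move=> iN; rewrite map_inj_in_uniq ?filter_uniq ?iota_uniq // => p q.
rewrite !mem_filter !mem_iota => /andP[okp pi] /andP[okq qi].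
by apply: addbox_inj => //; lia.
Qed.

Lemma fdeg_addbox x i p : (0 < p <= i)%N -> (i < n)%N -> addable x i p ->
  fdeg (addbox x i p) = incr (fdeg x) i.
Proof.
move=> pi iN ok; apply: dg_inj => k kN; rewrite dg_incr; last by lia.
rewrite !dg_fdeg.
transitivity (\sum_(1 <= j < k.+1) (ent x k j + ((k == i) && (j == p))))%N.
  by rewrite big_nat [RHS]big_nat; apply: eq_bigr => j jk;
     rewrite ent_addbox; lia.
rewrite big_split /=; congr addn; have [->|ki] := eqVneq k i;
  last by rewrite big1.
rewrite (bigD1_seq p) ?iota_uniq ?mem_index_iota //= eqxx.
by rewrite big1 // => j /negPf->.
Qed.

Lemma mem_covers i x y : (0 < i < n)%N -> (y \in covers i x) = incident i x y.
Proof.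
move=> iN; apply/coversP/and3P =>
  [[p [pi ok ->]]|[/eqP dxy /allP rows /allP row_i]].
  split; first by rewrite fdeg_addbox //; lia.
    apply/allP => k; rewrite mem_iota => kN; apply/implyP => /negPf ki.
    apply/allP => j; rewrite mem_iota => jk.
    by rewrite ent_addbox // ?ki ?addn0 ?eqxx //; lia.
  apply/allP => j; rewrite mem_iota => ji; rewrite ent_addbox //; lia.
have rowE k j : (0 < j <= k)%N -> (k < n)%N -> k != i -> ent y k j = ent x k j.
  move=> jk kN ki; have kI : k \in iota 1 n.-1 by rewrite mem_iota; lia.
  have jI : j \in iota 1 k by rewrite mem_iota; lia.
  exact/eqP/(allP (implyP (rows k kI) ki) j jI).
have le_i j : (0 < j <= i)%N -> (ent x i j <= ent y i j)%N.
  by move=> ji; apply: row_i; rewrite mem_iota; lia.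
have : (\sum_(1 <= j < i.+1) (ent y i j - ent x i j) = 1)%N.
  apply/(@addnI (\sum_(1 <= j < i.+1) ent x i j)%N); rewrite -big_split /=.
  have := dg_incr (fdeg x) i iN; rewrite -dxy eqxx !dg_fdeg => <-.
  rewrite big_nat [RHS]big_nat; apply: eq_bigr => j ji.
  by rewrite subnKC // le_i.
move=> /sum_nat_seq_eq1[p [pI _ px others]].
have pi : (0 < p <= i)%N by move: pI; rewrite mem_index_iota.
have ynE j : (0 < j <= i)%N -> ent y i j = (ent x i j + (j == p))%N.
  move=> ji; have := le_i j ji; have [->|jp] := eqVneq j p.
    by rewrite /=; lia.
  by have := others j jp; rewrite mem_index_iota => /(_ ji isT); lia.
have ok : addable x i p.
  rewrite /addable; have [//|pi'] := eqVneq p i; rewrite /=.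
  have := @ent_mono y i i.-1 p; rewrite (@rowE i.-1) ?ynE ?eqxx //; lia.
exists p; split=> //; apply: fixpt_ext => a b ba aN; rewrite ent_addbox //.
by have [ai|ai] := eqVneq a i; [subst a; apply: ynE | rewrite addn0 rowE].
Qed.

Lemma fdeg_covers i x y :
  (0 < i < n)%N -> y \in covers i x -> fdeg y = incr (fdeg x) i.
Proof. by move=> iN; rewrite mem_covers // => /and3P[/eqP]. Qed.

(* Removing a box, or moving it to the right, lowers [tilt]. *)
Definition tilt x : nat :=
  (\sum_(1 <= i < n) \sum_(1 <= j < i.+1) (n - j) * ent x i j)%N.

Lemma tilt_addbox x i p : (0 < p <= i)%N -> (i < n)%N -> addable x i p ->
  tilt (addbox x i p) = (tilt x + (n - p))%N.
Proof.
move=> pi iN ok; rewrite /tilt.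
rewrite (bigD1_seq i) ?iota_uniq ?mem_index_iota //=; last by lia.
rewrite [in RHS](bigD1_seq i) ?iota_uniq ?mem_index_iota //=; last by lia.
set A := (X in (_ + X = _)%N); set B := (X in (_ = _ + X + _)%N).
have -> : A = B.
  rewrite /A big_seq_cond [RHS]big_seq_cond; apply: eq_bigr => k /andP[].
  rewrite mem_index_iota => kN /negPf ki; rewrite big_nat [RHS]big_nat.
  by apply: eq_bigr => j jk; rewrite ent_addbox // ?ki ?addn0; lia.
rewrite (bigD1_seq p) ?iota_uniq ?mem_index_iota //=.
rewrite [in RHS](bigD1_seq p) ?iota_uniq ?mem_index_iota //=.
set C := (X in (_ + X + _ = _)%N); set D := (X in (_ = _ + X + _ + _)%N).
have -> : C = D.
  rewrite /C big_seq_cond [RHS]big_seq_cond; apply: eq_bigr => j /andP[].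
  rewrite mem_index_iota => ji /negPf jp.
  by rewrite ent_addbox // jp andbF addn0.
by rewrite ent_addbox // !eqxx mulnDr muln1 -!addnA; congr addn;
  rewrite addnC -addnA.
Qed.

Lemma removable_box y : y != fixpt0 n -> exists i x,
  [/\ (0 < i < n)%N, y \in covers i x, (tilt x < tilt y)%N &
      {in covers i x, forall y', y' != y -> (tilt y' < tilt y)%N}].
Proof.
move=> y0.
pose P p := (0 < p)%N && has (fun a => (p <= a)%N &&
  (0 < ent y a p)%N) (iota 1 n.-1).
have exP : exists p, P p.
  have [/allP z|/allPn[a aI /allPn[b bI yab]]] := boolP (all (fun a =>
    all (fun b => ent y a b == 0%N) (iota 1 a)) (iota 1 n.-1)).
    case/eqP: y0; apply: fixpt_ext => a b ba aN; rewrite ent_fixpt0.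
    have aI : a \in iota 1 n.-1 by rewrite mem_iota; lia.
    have bI : b \in iota 1 a by rewrite mem_iota; lia.
    exact/eqP/(allP (z a aI) b bI).
  move: bI; rewrite mem_iota => bI; exists b; rewrite /P; apply/andP.
  by split; [lia | apply/hasP; exists a => //; lia].
case: (ex_minnP exP) => p /andP[p0 /hasP[a0]]; rewrite mem_iota => a0N.
move=> /andP[pa0 ya0] pmin.
have col0 b a : (0 < b < p)%N -> (b <= a)%N -> (a < n)%N -> ent y a b = 0%N.
  move=> bp ba aN; apply/eqP; rewrite -leqn0 leqNgt; apply/negP => yab.
  have /pmin : P b by rewrite /P; apply/andP; split; [lia|];
    apply/hasP; exists a; rewrite ?mem_iota ?ba //; lia.
  lia.
pose Q a := (p <= a < n)%N && (0 < ent y a p)%N.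
have exQ : exists a, Q a by exists a0; rewrite /Q ya0 pa0; lia.
case: (@ex_maxnP Q n exQ) => [a /andP[]|i /andP[pi yi] imax]; first by lia.
pose g a b := (ent y a b - ((a == i) && (b == p)))%N.
have gmono : column_mono g.
  move=> a c b bc ca aN; rewrite /g.
  have le_ac := @ent_mono y a c b bc ca aN.
  have [ci|ci] := eqVneq c i; last by rewrite /=; lia.
  have [bp|bp] := eqVneq b p; last by rewrite andbF; lia.
  subst; have [->|ai] := eqVneq a i; first by [].
  rewrite /= subn0 [ent y a p](_ : _ = 0%N) //; apply/eqP.
  rewrite -leqn0 leqNgt; apply/negP => yap.
  by have := imax a; rewrite /Q yap; lia.
pose x := mk_fixpt g.
have xE a b : (0 < b <= a)%N -> (a < n)%N -> ent x a b = g a b.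
  exact: ent_mk_fixpt.
have iN : (0 < i < n)%N by lia.
have ok : addable x i p.
  rewrite /addable; have [//|pi'] := eqVneq p i; rewrite /= !xE /g ?eqxx;
    try lia.
  have -> : (i.-1 == i) = false by apply/eqP; lia.
  by have := @ent_mono y i i.-1 p; lia.
have yE : y = addbox x i p.
  apply: fixpt_ext => a b ba aN; rewrite ent_addbox //; last by lia.
  rewrite xE // /g; have [->|ai] := eqVneq a i; have [->|bp] := eqVneq b p;
    rewrite /= ?subn0 ?addn0 //; lia.
have pi1 : (0 < p <= i)%N by lia.
exists i, x; split=> //.
- by apply/coversP; exists p; split.
- by rewrite yE tilt_addbox //; lia.
move=> y' /coversP[q [qi okq ->]]; have [->|qp _] := eqVneq q p.
  by rewrite -yE eqxx.
rewrite yE !tilt_addbox //; try lia.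
suff : (p < q)%N by lia.
have [//|qlt|/eqP] := ltngtP p q; last by rewrite eq_sym (negPf qp).
case/orP: okq => [/eqP|]; first by lia.
rewrite !xE; [|lia..]; rewrite /g (col0 q i.-1); lia.
Qed.

End FixedPoints.

(** * Ratios of tangent weights and their sums *)

Section Localization.
Variables (R : realType) (F : fieldType) (n : nat) (t : nat -> F) (v : F).
Hypothesis hn : (2 <= n)%N.
Hypothesis gen : generic_params n t v.
Implicit Types (x y : fixpt n) (i j k p : nat).

Local Notation w := (weight_factor t v).
Local Notation hom_prod := (hom_prod n t v).
Local Notation schi := (schi n t v R).

Lemma rk_chainE i x y : (0 < i < n)%N ->
  all (fun T => rk T <= n)%N (chainE i x y).
Proof.
move=> iN; rewrite all_cat /= !all_map; apply/and3P; split.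
- by apply/allP => k; rewrite mem_iota /=; lia.
- by lia.
- by apply/allP => k; rewrite mem_iota /=; lia.
Qed.

Lemma rk_chainQ x : all (fun T => rk T <= n)%N (chainQ x).
Proof. by rewrite all_map; apply/allP => k; rewrite mem_iota /=; lia. Qed.

Lemma subsheaf_flagW x k : (k.+1 < n)%N -> subsheaf (flagW x k) (flagW x k.+1).
Proof.
move=> kN; apply/subsheafP; split=> //= j jk.
by apply: (@ent_mono n x); lia.
Qed.

Lemma path_flagW x k m : (k + m < n)%N ->
  path subsheaf (flagW x k) [seq flagW x a | a <- iota k.+1 m].
Proof.
elim: m k => //= m IH k km; rewrite subsheaf_flagW /=; last by lia.
by apply: IH; lia.
Qed.

Lemma last_flagW x k m :
  last (flagW x k) [seq flagW x a | a <- iota k.+1 m] = flagW x (k + m).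
Proof. by elim: m k => [|m IH] k /=; rewrite ?addn0 // IH addnS. Qed.

Definition below x i := [seq flagW x a | a <- iota 1 i.-1].
Definition above x i := [seq flagW x a | a <- iota i.+1 (n - i).-1].

Lemma chainQE x i : (0 < i < n)%N ->
  chainQ x = below x i ++ flagW x i :: above x i.
Proof.
move=> iN; rewrite /chainQ (_ : n.-1 = i.-1 + (n - i).-1.+1)%N; last by lia.
by rewrite iotaD map_cat /= add1n prednK //; lia.
Qed.

Lemma chainEE x y i : (0 < i < n)%N ->
  chainE i x y = below x i ++ flagW y i :: flagW x i :: above x i.
Proof.
by move=> iN; rewrite /chainE (_ : n - i = (n - i).-1.+1)%N; last by lia.
Qed.

Lemma last_below x i : (0 < i)%N -> last (flagW x 0) (below x i) = flagW x i.-1.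
Proof. by move=> i0; rewrite last_flagW. Qed.

Lemma path_chainQ x : path subsheaf (flagW x 0) (chainQ x).
Proof. by apply: path_flagW; lia. Qed.

Lemma path_chainE i x p : (0 < i < n)%N -> (0 < p <= i)%N -> addable x i p ->
  path subsheaf (flagW x 0) (chainE i x (addbox x i p)).
Proof.
move=> iN pi ok; have iN' : (i < n)%N by lia.
have yE j : (0 < j <= i)%N -> ent (addbox x i p) i j = (ent x i j + (j == p))%N.
  by move=> ji; rewrite ent_addbox // eqxx.
rewrite chainEE // cat_path last_below; last by lia.
rewrite path_flagW; last by lia.
rewrite /= path_flagW ?andbT; last by lia.
apply/andP; split; last first.
  by apply/subsheafP; split=> //= j ji; rewrite yE //; lia.
apply/subsheafP; split=> /= [|j ji]; first by lia.
have yO k : (k != i) -> (0 < j <= k)%N -> (k < n)%N ->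
    ent (addbox x i p) k j = ent x k j.
  by move=> ki jk kN; rewrite ent_addbox // (negPf ki) addn0.
rewrite -(yO i.-1); [|by lia..].
by apply: (@ent_mono n); lia.
Qed.

Lemma schiE0 S ch : rk S = 0%N -> (0 < size ch)%N ->
  path subsheaf S ch -> all (fun T => rk T <= n)%N ch ->
  schi ch = chain_prod hom_prod S ch / \prod_(T <- ch) hom_prod T T.
Proof.
case: ch => //= T ch rS _ /andP[_ ch_sub] ch_rk.
by rewrite schiE // /hom_prod rS [X in _ = X * _ / _]big_geq // mul1r.
Qed.

Lemma chain_prod_neq0 S ch : path subsheaf S ch ->
  all (fun T => rk T <= n)%N ch -> chain_prod hom_prod S ch != 0.
Proof.
elim: ch S => [|T ch IH] S /=; first by rewrite oner_neq0.
move=> /andP[ST ch_sub] /andP[rT ch_rk].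
by rewrite mulf_neq0 ?IH // hom_prod_neq0.
Qed.

Lemma schi_neq0 S ch : rk S = 0%N -> (0 < size ch)%N ->
  path subsheaf S ch -> all (fun T => rk T <= n)%N ch -> schi ch != 0.
Proof.
move=> rS ch0 ch_sub ch_rk; rewrite (schiE0 rS) //.
rewrite mulf_neq0 ?chain_prod_neq0 // invr_neq0 //.
rewrite prodf_seq_neq0; elim: (ch) ch_rk => //= T s IH /andP[rT rs].
rewrite IH // andbT hom_prod_neq0 //.
by apply/subsheafP.
Qed.

Lemma schi_chainQ_neq0 x : schi (chainQ x) != 0.
Proof.
apply: (@schi_neq0 (flagW x 0)); rewrite ?path_chainQ ?rk_chainQ //.
by rewrite size_map size_iota; lia.
Qed.

Lemma schi_chainE_neq0 i x y : (0 < i < n)%N -> y \in covers i x ->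
  schi (chainE i x y) != 0.
Proof.
move=> iN /coversP[p [pi ok ->]].
apply: (@schi_neq0 (flagW x 0)); rewrite ?path_chainE ?rk_chainE //.
by rewrite size_cat /= addnS.
Qed.

Lemma schi_ratio i x p : (0 < i < n)%N -> (0 < p <= i)%N -> addable x i p ->
  schi (chainE i x (addbox x i p)) / schi (chainQ x) =
  \prod_(1 <= j < i) w j p ((ent x i p)%:Z - (ent x i.-1 j)%:Z) /
  \prod_(1 <= j < i.+1)
    w j p ((ent x i p)%:Z - (ent (addbox x i p) i j)%:Z).
Proof.
move=> iN pi ok; have iN' : (i < n)%N by lia.
have i0 : (0 < i)%N by lia.
set y := addbox x i p.
have yE j : (0 < j <= i)%N -> ent y i j = (ent x i j + (j == p))%N.
  by move=> ji; rewrite ent_addbox // eqxx.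
have pE : path subsheaf (flagW x 0) (chainE i x y) by apply: path_chainE.
rewrite (@schiE0 (flagW x 0) (chainE i x y)) ?rk_chainE //; last first.
  by rewrite size_cat /= addnS.
rewrite (@schiE0 (flagW x 0) (chainQ x)) ?path_chainQ ?rk_chainQ //; last first.
  by rewrite size_map size_iota; lia.
move: pE (rk_chainE x y iN); have := path_chainQ x; have := rk_chainQ x.
rewrite chainEE // (@chainQE x i) // !chain_prod_cat !big_cat !big_cons /=.
rewrite last_below; last by lia.
rewrite !cat_path !all_cat /= last_below; last by lia.
move=> /and3P[rb rx ra] /and3P[pb px pa] /and4P[_ py pyx _] /and4P[_ ry _ _].
have hb := chain_prod_neq0 pb rb; have ha := chain_prod_neq0 pa ra.
have hx := hom_prod_neq0 gen px rx.
have sxx : subsheaf (flagW x i) (flagW x i) by apply/subsheafP.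
have hxx := hom_prod_neq0 gen sxx rx.
have syy : subsheaf (flagW y i) (flagW y i) by apply/subsheafP.
have hyy := hom_prod_neq0 gen syy ry.
have hyx := hom_prod_neq0 gen pyx rx.
have hprod s : all (fun T => rk T <= n)%N s ->
    \prod_(T <- s) hom_prod T T != 0.
  rewrite prodf_seq_neq0; elim: s => //= T s IH /andP[rT rs].
  by rewrite IH // andbT hom_prod_neq0 //; apply/subsheafP.
have hpb := hprod _ rb; have hpa := hprod _ ra.
have E1 : hom_prod (flagW x i.-1) (flagW y i) =
    hom_prod (flagW x i.-1) (flagW x i) *
    \prod_(1 <= j < i) w j p ((ent x i p)%:Z - (ent x i.-1 j)%:Z).
  rewrite (hom_prod_incr t v (flagW x i.-1) (rx : (rk (flagW x i) <= n)%N) (erefl : rk (flagW y i) = _) pi yE).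
  by congr (_ * _); rewrite -[in RHS](prednK i0).
have E2 : hom_prod (flagW y i) (flagW y i) =
    hom_prod (flagW y i) (flagW x i) *
    \prod_(1 <= j < i.+1) w j p ((ent x i p)%:Z - (ent y i j)%:Z).
  exact: (hom_prod_incr t v (flagW y i) (rx : (rk (flagW x i) <= n)%N) (erefl : rk (flagW y i) = _) pi yE).
rewrite E2 in hyy *; rewrite E1.
rewrite mulf_eq0 negb_or in hyy; case/andP: hyy => _ hden.
move: hb ha hx hxx hyx hpb hpa hden; rewrite /=.
set b := chain_prod _ _ _; set a := chain_prod _ _ _.
set c := hom_prod _ _; set d := hom_prod _ _; set e := hom_prod _ _.
set g := \prod_(T <- _) _; set h := \prod_(T <- _) _.
set m := \prod_(1 <= j < i.+1) _; set q := \prod_(1 <= j < i) _.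
move=> hb ha hc hd he hg hh hm; clearbody a b c d e g h m q.
by field; rewrite ?hb ?ha ?hc ?hd ?he ?hg ?hh ?hm.
Qed.

(* The character of the generator of the [j]-th summand of W_i. *)
Definition gen_char x i j : F := t j ^+ 2 * v ^- (2 * ent x i j).

Lemma gen_char_neq0 x i j : (0 < j <= n)%N -> gen_char x i j != 0.
Proof.
case: gen => v0 t0 _ jn.
by rewrite mulf_neq0 ?invr_neq0 ?expf_neq0 ?v0 ?t0.
Qed.

Lemma weight_factorE j l (a b : nat) : (0 < j <= n)%N ->
  w j l (a%:Z - b%:Z) =
  1 - (t l ^+ 2 * v ^- (2 * a)) / (t j ^+ 2 * v ^- (2 * b)).
Proof.
case: gen => v0 t0 _ jn; rewrite /weight_factor.
have -> : - (2 * (a%:Z - b%:Z)) = (2 * b)%N%:Z - (2 * a)%N%:Z by lia.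
rewrite expfzDr // -exprnP -exprnN; congr (1 - _).
have va := expf_neq0 (2 * a) v0; have vb := expf_neq0 (2 * b) v0.
by field; rewrite va vb (t0 j jn).
Qed.

Lemma gen_char_inj x i : (i < n)%N ->
  {in iota 1 i &, injective (fun j => (gen_char x i j)^-1)}.
Proof.
case: gen => v0 t0 indep iN j k; rewrite !mem_iota => jI kI /invr_inj E.
have := indep k j (2 * ent x i k)%N (2 * ent x i j)%N.
have va := expf_neq0 (2 * ent x i j) v0;
  have vb := expf_neq0 (2 * ent x i k) v0.
case=> [|||-> //]; [lia|lia|].
move/eqP: E; rewrite /gen_char eqr_div // => /eqP->.
by rewrite mulrC.
Qed.

Lemma schi_term i x p : (0 < i < n)%N -> (0 < p <= i)%N -> addable x i p ->
  schi (chainE i x (addbox x i p)) / schi (chainQ x) =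
  (1 - v ^+ 2)^-1 *
  (\prod_(j <- iota 1 i.-1) (1 - gen_char x i p / gen_char x i.-1 j) /
   \prod_(j <- iota 1 i | j != p) (1 - gen_char x i p / gen_char x i j)).
Proof.
move=> iN pi ok; have iN' : (i < n)%N by lia.
rewrite schi_ratio // [\prod_(1 <= j < i.+1) _](bigD1_seq p) ?iota_uniq //=;
  last by rewrite mem_index_iota; lia.
rewrite ent_addbox // !eqxx addn1.
rewrite [X in w p p X](_ : _ = -1); last by lia.
rewrite {2}/weight_factor mulrN1 opprK divff; last first.
  by case: gen => _ t0 _; rewrite expf_neq0 // t0; lia.
rewrite mul1r invfM mulrCA; congr (_ * (_ / _)).
  rewrite /index_iota subn1 big_seq [RHS]big_seq; apply: eq_bigr => j.
  by rewrite mem_iota => ji; rewrite weight_factorE //; lia.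
rewrite /index_iota subn1 /= big_seq_cond [RHS]big_seq_cond.
apply: eq_bigr => j /andP[]; rewrite mem_iota => ji /negPf jp.
rewrite weight_factorE; last by lia.
by rewrite ent_addbox ?jp ?andbF ?addn0 //; lia.
Qed.

(* The terms of the sum which do not come from a fixed point vanish. *)
Lemma sum_covers i x (f : nat -> F) (g : fixpt n -> F) : (0 < i < n)%N ->
  (forall p, (0 < p <= i)%N -> addable x i p -> g (addbox x i p) = f p) ->
  \sum_(y <- covers i x) schi (chainE i x y) * g y =
  schi (chainQ x) / (1 - v ^+ 2) *
  \sum_(p <- iota 1 i) f p *
  (\prod_(j <- iota 1 i.-1) (1 - gen_char x i p / gen_char x i.-1 j) /
   \prod_(j <- iota 1 i | j != p) (1 - gen_char x i p / gen_char x i j)).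
Proof.
move=> iN gf; rewrite big_map big_filter big_mkcond mulr_sumr big_seq.
rewrite [RHS]big_seq; apply: eq_bigr => p; rewrite mem_iota => pI.
have pi : (0 < p <= i)%N by lia.
case: ifP => [ok|/norP[pi' nok]].
  have Q0 := schi_chainQ_neq0 x; rewrite gf // -[schi (chainE _ _ _)](divfK Q0).
  by rewrite schi_term // mulrAC mulrC -!mulrA; congr (_ * (_ * _));
    rewrite mulrA mulrC.
have iE : ent x i.-1 p = ent x i p.
  have iN' : (i < n)%N by lia.
  by have := @ent_mono n x i i.-1 p; lia.
rewrite [X in _ * (_ * X)](_ : _ = 0) ?mulr0 //.
rewrite [X in X / _](bigD1_seq p) ?iota_uniq ?mem_iota //=; last by lia.
rewrite {2}/gen_char iE divff ?subrr ?mul0r //.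
by apply: gen_char_neq0; lia.
Qed.

Lemma sum_schi_covers i x : (0 < i < n)%N ->
  \sum_(y <- covers i x) schi (chainE i x y) = schi (chainQ x) / (1 - v ^+ 2).
Proof.
move=> iN; have iN' : (i < n)%N by lia.
under eq_bigr do rewrite -[schi _]mulr1.
rewrite (@sum_covers i x (fun=> 1)) // -[RHS]mulr1; congr (_ * _).
rewrite -[RHS](@sum_nodes _ (iota 1 i) (iota 1 i.-1) (fun j =>
  (gen_char x i j)^-1)
  (fun j => (gen_char x i.-1 j)^-1)) ?iota_uniq ?size_iota ?prednK //;
  [|exact: gen_char_inj|by lia].
rewrite big_seq [RHS]big_seq; apply: eq_bigr => p; rewrite mem_iota => pI.
have p0 := @gen_char_neq0 x i p.
rewrite -(@node_term _ (iota 1 i)) ?iota_uniq ?size_iota ?prednK ?mem_iota //.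
- rewrite mul1r invrK; congr (_ / _); apply: eq_bigr => j _; by rewrite mulrC.
- by lia.
- by rewrite invr_neq0 // p0; lia.
Qed.

Lemma sum_schi_covers_char i x (g : fixpt n -> F) : (0 < i < n)%N ->
  (forall p, (0 < p <= i)%N -> addable x i p ->
    g (addbox x i p) = gen_char x i p) ->
  \sum_(y <- covers i x) schi (chainE i x y) * g y =
  schi (chainQ x) / (1 - v ^+ 2) *
  (t i ^+ 2 * v ^ (2 * ((dg (fdeg x) i.-1)%:Z - (dg (fdeg x) i)%:Z))).
Proof.
move=> iN gE; have iN' : (i < n)%N by lia.
rewrite (@sum_covers i x (gen_char x i)) //; congr (_ * _).
transitivity (\prod_(j <- iota 1 i.-1) (gen_char x i.-1 j)^-1 /
   \prod_(j <- iota 1 i) (gen_char x i j)^-1).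
  rewrite -(@sum_nodes_inv _ (iota 1 i) (iota 1 i.-1)
    (fun j => (gen_char x i j)^-1) (fun j => (gen_char x i.-1 j)^-1))
    ?iota_uniq ?size_iota ?prednK //; first last.
  - by move=> j; rewrite mem_iota => jI; rewrite invr_neq0 // gen_char_neq0;
    lia.
  - by lia.
  - exact: gen_char_inj.
  rewrite big_seq [RHS]big_seq; apply: eq_bigr => p; rewrite mem_iota => pI.
  have p0 := @gen_char_neq0 x i p.
  rewrite -(@node_term _ (iota 1 i)) ?iota_uniq ?size_iota ?prednK ?mem_iota //.
  - rewrite invrK; congr (_ * (_ / _)); apply: eq_bigr => j _; by rewrite mulrC.
  - by lia.
  - by rewrite invr_neq0 // p0; lia.
have prodE k : \prod_(j <- iota 1 k) (gen_char x k j)^-1 =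
    (\prod_(j <- iota 1 k) t j ^+ 2)^-1 * v ^+ (2 * dg (fdeg x) k).
  rewrite dg_fdeg -prodfV big_distrr /= expr_sum /index_iota subn1 /=.
  by rewrite -big_split; apply: eq_bigr => j _; rewrite invfM invrK.
have iotaE : iota 1 i = iota 1 i.-1 ++ [:: i].
  have i0 : (0 < i)%N by lia.
  by rewrite -{1}(prednK i0) -[i.-1.+1]addn1 iotaD /= add1n prednK.
rewrite !prodE iotaE big_cat big_seq1 /=.
case: gen => v0 t0 _.
have -> : 2 * ((dg (fdeg x) i.-1)%:Z - (dg (fdeg x) i)%:Z) =
  (2 * dg (fdeg x) i.-1)%N%:Z - (2 * dg (fdeg x) i)%N%:Z by lia.
rewrite expfzDr // -exprnP -exprnN.
have va := expf_neq0 (2 * dg (fdeg x) i) v0.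
have ti : t i != 0 by apply: t0; lia.
have : \prod_(j <- iota 1 i.-1) t j ^+ 2 != 0.
  rewrite prodf_seq_neq0; apply/allP => j; rewrite mem_iota => jI.
  by rewrite /= expf_neq0 // t0; lia.
set P := \prod_(j <- _) _; set a := v ^+ _; set b := v ^+ _ in va *.
move=> P0; clearbody P a b.
by field; rewrite va ti P0.
Qed.

Definition det_char x : F :=
  \prod_(1 <= i < n) \prod_(1 <= j < i.+1)
    ((\prod_(0 <= m < 1 | (ent x i j <= m)%N) (t j ^+ 2 * v ^- (2 * m))) /
     (\prod_(1 <= m < ent x i j) (t j ^+ 2 * v ^- (2 * m)))).

Lemma det_char_neq0 x : det_char x != 0.
Proof.
case: gen => v0 t0 _.
rewrite prodf_seq_neq0; apply/allP => i; rewrite mem_index_iota => iN /=.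
rewrite prodf_seq_neq0; apply/allP => j; rewrite mem_index_iota => ji /=.
have tv m : t j ^+ 2 * v ^- (2 * m) != 0.
  by rewrite mulf_neq0 ?invr_neq0 ?expf_neq0 // t0; lia.
rewrite mulf_neq0 ?invr_neq0 // prodf_seq_neq0; apply/allP => m _ /=.
  by apply/implyP.
by rewrite tv.
Qed.

Lemma det_char_addbox x i p : (0 < i < n)%N -> (0 < p <= i)%N ->
  addable x i p ->
  det_char x / det_char (addbox x i p) = gen_char x i p.
Proof.
move=> iN pi ok; have iN' : (i < n)%N by lia.
have d0 := det_char_neq0 (addbox x i p).
apply: (mulIf d0); rewrite divfK //; clear d0; set y := addbox x i p.
have yE a b : (0 < b <= a)%N -> (a < n)%N ->
  ent y a b = (ent x a b + ((a == i) && (b == p)))%N by exact: ent_addbox.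
rewrite /det_char (bigD1_seq i) ?iota_uniq ?mem_index_iota //=.
rewrite [in RHS](bigD1_seq i) ?iota_uniq ?mem_index_iota //= [RHS]mulrA.
congr (_ * _); last first.
  rewrite big_seq_cond [RHS]big_seq_cond; apply: eq_bigr => k /andP[].
  rewrite mem_index_iota => kN /negPf ki; rewrite big_nat [RHS]big_nat.
  by apply: eq_bigr => j jk; rewrite yE ?ki ?addn0 //; lia.
rewrite (bigD1_seq p) ?iota_uniq ?mem_index_iota //=.
rewrite [in RHS](bigD1_seq p) ?iota_uniq ?mem_index_iota //= [RHS]mulrA.
congr (_ * _); last first.
  rewrite big_seq_cond [RHS]big_seq_cond; apply: eq_bigr => j /andP[].
  rewrite mem_index_iota => ji /negPf jp.
  by rewrite yE ?jp ?andbF ?addn0 //; lia.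
rewrite yE // !eqxx addn1 /gen_char.
have tv : t p ^+ 2 * v ^- (2 * ent x i p) != 0.
  by apply: gen_char_neq0; lia.
have cond (b : nat) (g : nat -> F) :
    \prod_(0 <= m < 1 | (b <= m)%N) g m = if b == 0%N then g 0%N else 1.
  by rewrite big_mkcond big_nat1; case: b.
rewrite !cond; case: (ent x i p) tv => [|a] tv /=.
  by rewrite !big_geq // !divr1 mulr1.
by rewrite [in RHS]big_nat_recr //= !mul1r invfM mulrCA divff ?mulr1.
Qed.

Lemma fibre_char_addbox x i p : (0 < i < n)%N -> (0 < p <= i)%N ->
  addable x i p ->
  \sum_(1 <= j < i.+1) \sum_(ent x i j <= m < ent (addbox x i p) i j)
    t j ^+ 2 * v ^- (2 * m) = gen_char x i p.
Proof.
move=> iN pi ok; have iN' : (i < n)%N by lia.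
rewrite (bigD1_seq p) ?iota_uniq ?mem_index_iota //=.
rewrite ent_addbox // !eqxx addn1 big_nat1 big_seq_cond big1 ?addr0 // => j.
rewrite mem_index_iota => /andP[ji /negPf jp].
by rewrite ent_addbox // jp andbF addn0 big_geq.
Qed.

End Localization.

(** * Lowering operators, Whittaker vectors and the Shapovalov form *)

Lemma finite_fdeg (n : nat) (d : degree n) :
  finite_set [set x : fixpt n | fdeg x = d]%classic.
Proof.
pose N := total d.
pose f (g : {ffun 'I_n.+1 * 'I_n.+1 -> 'I_N.+1}) : fixpt n :=
  mk_fixpt n (fun i j => g (inord i, inord j)).
apply: (@sub_finite_set _ _ (f @` setT)%classic); last first.
  by apply: finite_image; apply: finite_finset.
move=> x /= dx;
  exists [ffun ij : 'I_n.+1 * 'I_n.+1 =>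
    inord (ent x ij.1 ij.2) : 'I_N.+1] => //.
have gE i j : (0 < j <= i)%N -> (i < n)%N ->
    [ffun ij : 'I_n.+1 * 'I_n.+1 => inord (ent x ij.1 ij.2) : 'I_N.+1]
      (inord i, inord j) = ent x i j :> nat.
  move=> ji iN; rewrite ffunE /= !inordK //; try lia.
  rewrite /N -dx /total (bigD1_seq i) ?iota_uniq ?mem_index_iota //=;
    last by lia.
  rewrite dg_fdeg (bigD1_seq j) ?iota_uniq ?mem_index_iota //=.
  by rewrite ltnS -addnA leq_addr.
apply: fixpt_ext => i j ji iN;
  rewrite ent_mk_fixpt ?gE // => {ji iN}a b c bc ba aN.
by rewrite !gE; [apply: (@ent_mono n) | lia..].
Qed.

Lemma finite_incident (n i : nat) (y : fixpt n) :
  finite_set [set x : fixpt n | incident i x y]%classic.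
Proof.
pose d : degree n := [tuple (tnth (fdeg y) k - (k.+1 == i))%N | k < n.-1].
apply: (sub_finite_set _ (finite_fdeg d)) => x /and3P[/eqP dxy _ _] /=.
by apply: eq_from_tnth => k;
  rewrite [RHS]tnth_mktuple dxy [X in (X - _)%N]tnth_mktuple addnK.
Qed.

Section FreeModule.
Variables (K : fieldType) (T : choiceType).
Implicit Types (m : {malg K[T]}) (x y z : T).

Definition linext (g : T -> {malg K[T]}) m : {malg K[T]} :=
  \sum_(x <- msupp m) mcoeff x m *: g x.

Lemma mcoeff_sum (I : Type) (r : seq I) (P : pred I) (F : I -> {malg K[T]}) z :
  mcoeff z (\sum_(i <- r | P i) F i) = \sum_(i <- r | P i) mcoeff z (F i).
Proof. exact: raddf_sum. Qed.

Lemma mcoeff_linext g m z :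
  mcoeff z (linext g m) = \sum_(x <- msupp m) mcoeff x m * mcoeff z (g x).
Proof. by rewrite mcoeff_sum; apply: eq_bigr => x _; rewrite mcoeffZ. Qed.

Lemma linextU g x : linext g << x >> = g x.
Proof. by rewrite /linext msuppU oner_eq0 big_seq_fset1 mcoeffUU scale1r. Qed.

Lemma sum_msupp m (r : seq T) (h : T -> K) : uniq r ->
  \sum_(x <- msupp m) mcoeff x m * (if x \in r then h x else 0) =
  \sum_(x <- r) mcoeff x m * h x.
Proof.
move=> Ur; rewrite [RHS](bigID (fun x => x \in msupp m)) /=.
rewrite [X in _ = _ + X]big1 ?addr0 => [|x]; last first.
  by rewrite -mcoeff_eq0 => /eqP->; rewrite mul0r.
rewrite (eq_bigr (fun x => if x \in r then mcoeff x m * h x else 0));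
  last first.
  by move=> x _; case: ifP; rewrite ?mulr0.
rewrite -big_mkcond -big_filter -[RHS]big_filter; apply: perm_big.
apply: uniq_perm; rewrite ?filter_uniq ?fset_uniq // => x.
by rewrite !mem_filter andbC.
Qed.

Lemma mcoeff_fsbig (A : classical_sets.set T) (c : T -> K) z : finite_set A ->
  mcoeff z (\sum_(x \in A) c x *: << x >>) = if z \in A then c z else 0.
Proof.
move=> finA; rewrite fsbig_finite // mcoeff_sum -(in_fset_set finA).
transitivity (\sum_(x <- fset_set A | x == z) c x).
  rewrite [RHS]big_mkcond; apply: eq_bigr => x _.
  by rewrite mcoeffZ mcoeffU; case: eqP; rewrite ?mulr1 ?mulr0.
case: ifP => zA; last first.
  rewrite big_seq_cond big1 // => x /andP[xA /eqP xz].
  by rewrite -xz xA in zA.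
by rewrite (big_rem z) //= eqxx big_seq_cond big1 ?addr0 // => x /andP[];
   rewrite mem_rem_uniq ?fset_uniq // !inE => /andP[/negPf->].
Qed.

Lemma linextZU g a x : linext g (a *: << x >>) = a *: g x.
Proof.
apply/malgP => z; rewrite mcoeff_linext mcoeffZ.
rewrite (eq_bigr (fun y => mcoeff y (a *: << x >> : {malg K[T]}) *
  (if y \in [:: x] then mcoeff z (g y) else 0))) => [|y _].
  by rewrite sum_msupp // big_seq1 mcoeffZ mcoeffU eqxx mulr1.
rewrite mcoeffZ mcoeffU inE eq_sym; case: eqP => // _.
by rewrite mulr0 !mul0r.
Qed.

Lemma malg_linext m : m = linext (fun x => << x >>) m.
Proof.
apply/malgP => z; rewrite mcoeff_linext.
rewrite (eq_bigr (fun y => mcoeff y m * (if y \in [:: z] then 1 else 0))).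
  by rewrite sum_msupp // big_seq1 mulr1.
by move=> y _; rewrite mcoeffU inE; case: eqP.
Qed.

End FreeModule.

Lemma in_set_bool (T : Type) (b : pred T) x :
  (x \in [set x | b x]%classic) = b x.
Proof. by apply/idP/idP => [/set_mem //|bx]; apply: mem_set. Qed.

Section Operators.
Variables (K : fieldType) (n : nat).
Implicit Types (x y z : fixpt n) (i : nat) (d : degree n).
Local Notation M := {malg K[fixpt n]}.

(* [qe], [qq] : the factors S chi at the fixed points of E and of Q;
   [kap] : the eigenvalues of K_i; [pre], [lam] : the scalar prefactor of e_i
   and the fibre of L_i. *)
Variables (qe : nat -> fixpt n -> fixpt n -> K) (qq : fixpt n -> K).
Variables (kap : nat -> degree n -> K) (pre : nat -> fixpt n -> K)
  (lam : nat -> fixpt n -> fixpt n -> K).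
Hypothesis qe_neq0 : forall i x y, (0 < i < n)%N -> y \in covers i x ->
  qe i x y != 0.
Hypothesis qq_neq0 : forall x, qq x != 0.
Hypothesis qq0 : qq (fixpt0 n) = 1.
Hypothesis kap_neq0 : forall i d, (0 < i < n)%N -> kap i d != 0.
Hypothesis pre_neq0 : forall i x, (0 < i < n)%N -> pre i x != 0.
Hypothesis lam_neq0 : forall i x y, (0 < i < n)%N -> y \in covers i x ->
  lam i x y != 0.

Definition lower i : M -> M :=
  linext (fun y => \sum_(x \in [set x : fixpt n | incident i x y]%classic)
    (qe i x y / qq y) *: << x >>).

Definition raise i : M -> M :=
  linext (fun x => pre i x *:
    \sum_(y \in [set y : fixpt n | incident i x y]%classic)
      (lam i x y * qe i x y / qq x) *: << y >>).

Definition kpow i (p : int) : M -> M :=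
  linext (fun x => kap i (fdeg x) ^ p *: << x >>).

Definition kclass d (G : fixpt n -> K) : M :=
  \sum_(x \in [set x : fixpt n | fdeg x = d]%classic) (G x * qq x) *: << x >>.

Lemma mcoeff_lower i m x : (0 < i < n)%N ->
  mcoeff x (lower i m) = \sum_(y <- covers i x) mcoeff y m * (qe i x y / qq y).
Proof.
move=> iN; have iN' : (i < n)%N by case/andP: iN.
rewrite -(sum_msupp _ _ (covers_uniq x iN')) mcoeff_linext;
  apply: eq_bigr => y _.
congr (_ * _); rewrite mcoeff_fsbig; last exact: finite_incident.
by rewrite in_set_bool mem_covers.
Qed.

Lemma raiseU i x : (0 < i < n)%N ->
  raise i << x >> = \sum_(y <- covers i x)
    (pre i x * (lam i x y * qe i x y / qq x)) *: << y >>.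
Proof.
move=> iN; have iN' : (i < n)%N by case/andP: iN.
rewrite /raise linextU.
transitivity (pre i x *:
    \sum_(y <- covers i x) (lam i x y * qe i x y / qq x) *: << y >> : M).
  congr (_ *: _); rewrite [RHS]fsbig_seq; last exact: covers_uniq.
  by apply: eq_fsbigl; apply/seteqP; split=> y /=; rewrite mem_covers.
by rewrite scaler_sumr; apply: eq_bigr => y _; rewrite scalerA.
Qed.

Lemma mcoeff_kpow i p m x :
  mcoeff x (kpow i p m) = kap i (fdeg x) ^ p * mcoeff x m.
Proof.
rewrite mcoeff_linext (eq_bigr (fun y => mcoeff y m *
  (if y \in [:: x] then kap i (fdeg x) ^ p else 0))) => [|y _].
  by rewrite sum_msupp // big_seq1 mulrC.
rewrite mcoeffZ mcoeffU inE; case: eqP => [->|_]; first by rewrite mulr1.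
by rewrite !mulr0.
Qed.

Lemma kpowU i p x : kpow i p << x >> = kap i (fdeg x) ^ p *: << x >>.
Proof. exact: linextU. Qed.

Lemma mcoeff_kclass d G x :
  mcoeff x (kclass d G) = if fdeg x == d then G x * qq x else 0.
Proof.
rewrite mcoeff_fsbig; last exact: finite_fdeg.
by congr (if _ then _ else _); apply/idP/eqP => [/set_mem|dx];
  last apply: mem_set.
Qed.

Lemma in_weightP d (m : M) :
  (forall x, x \in msupp m -> fdeg x = d) <->
  (forall x, fdeg x != d -> mcoeff x m = 0).
Proof.
split=> [md x dx|md x]; first by apply: mcoeff_outdom;
  apply: contra dx => /md->.
by rewrite -mcoeff_neq0; apply: contraNeq => /md/eqP.
Qed.

Lemma lowerB i m1 m2 : (0 < i < n)%N ->
  lower i (m1 - m2) = lower i m1 - lower i m2.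
Proof.
move=> iN; apply/malgP => x; rewrite mcoeffB.
apply: (etrans (mcoeff_lower (m1 - m2) x iN)).
rewrite [X in _ = X - _]mcoeff_lower // [X in _ = _ - X]mcoeff_lower //.
rewrite -sumrB; apply: eq_bigr => y _.
by rewrite mcoeffB mulrBl.
Qed.

(* The triangularity of the lowering operators with respect to [tilt]. *)
Lemma lower_inj m : (forall i, (0 < i < n)%N -> lower i m = 0) ->
  m = mcoeff (fixpt0 n) m *: << fixpt0 n >>.
Proof.
move=> m0; suff H y : y != fixpt0 n -> mcoeff y m = 0.
  apply/malgP => y; rewrite mcoeffZ mcoeffU;
    have [->|y0] := eqVneq y (fixpt0 n).
    by rewrite mulr1.
  by rewrite H // mulr0.
have [N] := ubnP (tilt y); elim: N y => // N IH y yN y0.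
have [i [x [iN yx xy others]]] := removable_box y0.
have := congr1 (mcoeff x) (m0 i iN); rewrite mcoeff0 mcoeff_lower //.
rewrite (big_rem y) //= big_seq big1 ?addr0 => [/eqP|y'].
  by rewrite mulf_eq0 mulf_eq0 invr_eq0 (negPf (qe_neq0 iN yx)) (negPf (qq_neq0 y))
    !orbF => /eqP.
have /andP[_ iN'] := iN;
  rewrite (mem_rem_uniq _ (covers_uniq x iN')) !inE => /andP[y'y y'x];
    have ty' := others y' y'x y'y.
have [E|y'0] := eqVneq y' (fixpt0 n).
  have := fdeg_covers iN y'x; rewrite E fdeg_fixpt0 => /(congr1 (@total n)).
  rewrite total_incr // /total big1 // => k _;
    rewrite -fdeg_fixpt0 dg_fdeg big1 //.
  by move=> j _; rewrite ent_fixpt0.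
by rewrite IH ?mul0r //; apply: leq_trans ty' _.
Qed.

Section Uniqueness.
Variables (Top : nat -> M -> M) (mu : nat -> degree n -> K) (c : K).
Hypothesis mu_neq0 : forall i d, (0 < i < n)%N -> mu i d != 0.
Hypothesis TopE : forall i m x, (0 < i < n)%N ->
  mcoeff x (Top i m) = mu i (fdeg x) * mcoeff x (lower i m).

Definition whittaker (k : degree n -> M) : Prop :=
  [/\ forall d x, x \in msupp (k d) -> fdeg x = d,
      k (deg0 n) = << fixpt0 n >>
    & forall i d, (0 < i < n)%N -> Top i (k (incr d i)) = c *: k d].

Lemma eq_whittaker k k' : k =1 k' -> whittaker k' -> whittaker k.
Proof.
move=> kk' [kd' k0' kT']; split=> [d x||i d iN].
- by rewrite kk'; apply: kd'.
- by rewrite kk'.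
- by rewrite !kk'; apply: kT'.
Qed.

Lemma whittaker_unique k k' : whittaker k -> whittaker k' -> k =1 k'.
Proof.
move=> [kd k0 kT] [kd' k0' kT'] d.
have [N] := ubnP (total d); elim: N d => // N IH d dN.
have [->|d0] := eqVneq d (deg0 n); first by rewrite k0 k0'.
have wB x : fdeg x != d -> mcoeff x (k d - k' d) = 0.
  by rewrite mcoeffB => dx; rewrite ((in_weightP d (k d)).1 (kd d)) //
     ((in_weightP d (k' d)).1 (kd' d)) // subrr.
suff : k d - k' d = 0 by move/eqP; rewrite subr_eq0 => /eqP.
rewrite (@lower_inj (k d - k' d)) => [|i iN].
  by rewrite wB ?scale0r // fdeg_fixpt0 eq_sym.
apply/malgP => x; rewrite mcoeff0; have [dx|dx] := eqVneq (incr (fdeg x) i) d.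
  have E : Top i (k d) = Top i (k' d).
    rewrite -dx (kT _ _ iN) (kT' _ _ iN) IH; first by [].
    by rewrite -ltnS -(total_incr _ iN) dx.
  rewrite (lowerB (k d) (k' d) iN) (mcoeffB x (lower i (k d)) _).
  apply/eqP; rewrite subr_eq0; apply/eqP/(mulfI (mu_neq0 (fdeg x) iN)).
  by rewrite -[LHS]TopE // -[RHS]TopE // E.
rewrite (mcoeff_lower (k d - k' d) x iN) big_seq big1 // => y yx;
  rewrite wB ?mul0r //.
by rewrite (fdeg_covers iN yx).
Qed.

Lemma whittaker_kclass (be : degree n -> K) (G : fixpt n -> K) :
  be (deg0 n) * G (fixpt0 n) = 1 ->
  (forall i x, (0 < i < n)%N -> let d := fdeg x in
    mu i d * be (incr d i) * \sum_(y <- covers i x) qe i x y * G y =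
    c * (be d * (G x * qq x))) ->
  whittaker (fun d => be d *: kclass d G).
Proof.
move=> be0 beE; split=> [d||i d iN].
- apply/in_weightP => x /negPf dx.
  by rewrite mcoeffZ mcoeff_kclass dx mulr0.
- apply/malgP => x; rewrite mcoeffZ mcoeff_kclass mcoeffU.
  have [->|x0] := eqVneq x (fixpt0 n).
    by rewrite fdeg_fixpt0 eqxx qq0 mulr1 be0.
  case: eqP => [dx|_]; last by rewrite mulr0.
  have [i [x' [iN xx _ _]]] := removable_box x0.
  have := fdeg_covers iN xx; rewrite dx => /(congr1 (@total n)).
  rewrite total_incr // /total big1 // => k _;
    rewrite -fdeg_fixpt0 dg_fdeg big1 //.
  by move=> j _; rewrite ent_fixpt0.
apply/malgP => x; rewrite TopE // mcoeff_lower // mcoeffZ mcoeffZ mcoeff_kclass.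
have [dx|dx] := eqVneq (fdeg x) d; last first.
  rewrite !mulr0 big_seq big1 ?mulr0 // => y yx.
  rewrite mcoeffZ mcoeff_kclass (fdeg_covers iN yx) (inj_eq (incr_inj iN)).
  by rewrite (negPf dx) mulr0 mul0r.
have /= E := beE i x iN; rewrite -dx -E -mulrA; congr (_ * _);
  rewrite mulr_sumr.
rewrite big_seq [RHS]big_seq; apply: eq_bigr => y yx.
rewrite mcoeffZ mcoeff_kclass (fdeg_covers iN yx) eqxx.
by field.
Qed.

End Uniqueness.

Section Shapovalov.
Variable B : M -> M -> K.
Hypothesis B_lin : forall u : M, scalar (fun m => B m u).
Hypothesis B_sym : forall u u' : M, B u u' = B u' u.
Hypothesis B_vac : B << fixpt0 n >> << fixpt0 n >> = 1.

Let Eop i m := raise i (kpow i (- i%:Z) m).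
Let Fop i m := kpow i i%:Z (lower i m).

Hypothesis B_adj : forall i, (0 < i < n)%N -> forall u u' : M,
  B (Eop i u) u' = B u (Fop i u').

Lemma formD (m1 m2 y : M) : B (m1 + m2) y = B m1 y + B m2 y.
Proof. by rewrite -[m1 in LHS]scale1r (B_lin y 1 m1 m2) mul1r. Qed.

Lemma form0 (y : M) : B 0 y = 0.
Proof. by apply: (addrI (B 0 y)); rewrite -formD !addr0. Qed.

Lemma formZ a (m y : M) : B (a *: m) y = a * B m y.
Proof. by rewrite -[a *: m]addr0 (B_lin y a m 0) form0 addr0. Qed.

Lemma form_sum (I : Type) (r : seq I) (c : I -> K) (g : I -> M)
    (y : M) :
  B (\sum_(j <- r) c j *: g j) y = \sum_(j <- r) c j * B (g j) y.
Proof.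
elim: r => [|j r IH]; first by rewrite !big_nil form0.
by rewrite !big_cons formD formZ IH.
Qed.

Lemma form_expand (y m : M) :
  B y m = \sum_(x <- msupp m) mcoeff x m * B y << x >>.
Proof.
rewrite {1}(malg_linext m) B_sym /linext form_sum.
by apply: eq_bigr => x _; rewrite B_sym.
Qed.

Definition raise_coef i x y : K :=
  kap i (fdeg x) ^ (- i%:Z) * (pre i x * (lam i x y * qe i x y / qq x)).

Lemma raise_coef_neq0 i x y : (0 < i < n)%N -> y \in covers i x ->
  raise_coef i x y != 0.
Proof.
move=> iN yx; rewrite mulf_neq0 ?expfz_neq0 ?kap_neq0 //.
rewrite mulf_neq0 ?pre_neq0 // mulf_neq0 ?invr_neq0 //.
by rewrite mulf_neq0 ?qe_neq0 ?lam_neq0.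
Qed.

Lemma EopU i x : (0 < i < n)%N ->
  Eop i << x >> = kap i (fdeg x) ^ (- i%:Z) *: raise i << x >>.
Proof.
by move=> iN; rewrite /Eop kpowU /raise linextZU [in RHS]linextU.
Qed.

Lemma form_Eop i x m : (0 < i < n)%N ->
  B (Eop i << x >>) m = \sum_(y <- covers i x) raise_coef i x y * B << y >> m.
Proof.
move=> iN; rewrite (EopU x iN) (raiseU x iN) formZ form_sum mulr_sumr.
by apply: eq_bigr => y _; rewrite /raise_coef -[RHS]mulrA.
Qed.

Lemma tilt_covers i x y :
  (0 < i < n)%N -> y \in covers i x -> (tilt x < tilt y)%N.
Proof.
move=> iN /coversP[p [pi ok ->]]; have iN' : (i < n)%N by case/andP: iN.
rewrite tilt_addbox // -addn1 leq_add2l subn_gt0.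
by case/andP: pi => _ pi; apply: leq_ltn_trans iN'.
Qed.

Lemma msupp_Fop i m x : (0 < i < n)%N -> x \in msupp (Fop i m) ->
  exists2 y, y \in msupp m & y \in covers i x.
Proof.
move=> iN; rewrite -mcoeff_neq0 mcoeff_kpow (mcoeff_lower m x iN).
rewrite mulf_eq0 negb_or => /andP[_ nz].
have /hasP[y yx ym] : has (fun y => y \in msupp m) (covers i x).
  apply: contraNT nz => /hasPn out; rewrite big_seq big1 // => y yx.
  by rewrite mcoeff_outdom ?mul0r // out.
by exists y.
Qed.

Lemma form_orthogonal x y : fdeg x != fdeg y -> B << x >> << y >> = 0.
Proof.
have [N] := ubnP (tilt x + tilt y); elim: N x y => // N IH x y.
wlog x0 : x y / x != fixpt0 n.
  move=> W xyN dxy; have [xE|x0] := eqVneq x (fixpt0 n); last exact: W.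
  rewrite B_sym; apply: W; [|by rewrite addnC|by rewrite eq_sym].
  by apply: contraNneq dxy => ->; rewrite xE.
rewrite ltnS => xyN dxy; have [i [x' [iN xx' tx' others]]] := removable_box x0.
have iN' : (i < n)%N by case/andP: iN.
have dx := fdeg_covers iN xx'.
have : \sum_(z <- covers i x') raise_coef i x' z * B << z >> << y >> = 0.
  rewrite -(form_Eop x' << y >> iN) (B_adj iN) form_expand big_seq big1 // => z.
  case/(msupp_Fop iN) => y'.
  rewrite msuppU oner_eq0 inE => /eqP-> yz; rewrite IH ?mulr0 //.
    by apply: leq_trans xyN;
      rewrite -addSn leq_add // ltnW // (tilt_covers iN yz).
  by rewrite -(inj_eq (incr_inj iN)) -dx -(fdeg_covers iN yz).
rewrite (big_rem x) //= big_seq big1 ?addr0 => [/eqP|x''].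
  by rewrite mulf_eq0 (negPf (raise_coef_neq0 iN xx')) => /eqP.
rewrite (mem_rem_uniq _ (covers_uniq x' iN')) !inE => /andP[xx'' x''x'].
rewrite IH ?mulr0 //; last by rewrite (fdeg_covers iN x''x') -dx.
by apply: leq_trans xyN; rewrite ltn_add2r others.
Qed.

Lemma form_nondegenerate m : (forall x, B << x >> m = 0) -> m = 0.
Proof.
have [N] : exists N, forall x, x \in msupp m -> (tilt x < N)%N.
  exists (\max_(x <- msupp m) tilt x).+1 => x xm.
  by rewrite ltnS (leq_bigmax_seq x).
elim: N m => [|N IH] m mN rad.
  by apply/malgP => x; rewrite mcoeff0 mcoeff_outdom //; apply/negP => /mN.
have m0 : forall i, (0 < i < n)%N -> lower i m = 0.
  move=> i iN; have F0 : Fop i m = 0.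
    apply: IH => [x /(msupp_Fop iN)[y ym yx]|x].
      by apply: leq_trans (tilt_covers iN yx) _; rewrite -ltnS mN.
    rewrite -(B_adj iN) (form_Eop x m iN) big1 // => y _.
    by rewrite rad mulr0.
  apply/malgP => x; apply: (etrans _ (esym (@mcoeff0 _ K x))).
  apply: (mulfI (expfz_neq0 i%:Z (kap_neq0 (fdeg x) iN))); rewrite mulr0.
  rewrite -(mcoeff_kpow i i%:Z (lower i m) x).
  exact: (etrans (congr1 (mcoeff x) F0) (@mcoeff0 _ K x)).
have := rad (fixpt0 n); rewrite (lower_inj m0) B_sym formZ B_vac mulr1.
by move=> ->; rewrite scale0r.
Qed.

Lemma form_inj m1 m2 : (forall x, B << x >> m1 = B << x >> m2) -> m1 = m2.
Proof.
move=> E; have : -1 *: m2 + m1 = 0.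
  apply: form_nondegenerate => x.
  by rewrite B_sym (B_lin << x >> (-1) m2 m1) mulN1r B_sym -E [in X in _ + X]B_sym addNr.
by rewrite scaleN1r addrC => /eqP; rewrite subr_eq0 => /eqP.
Qed.

Lemma form_kpow i p x m :
  B << x >> (kpow i p m) = kap i (fdeg x) ^ p * B << x >> m.
Proof.
rewrite B_sym /kpow /linext form_sum [in RHS]form_expand mulr_sumr.
apply: eq_bigr => y _; rewrite formZ mulrCA [X in _ * (_ * X)]B_sym.
have [->|dxy] := eqVneq (fdeg x) (fdeg y); first by rewrite mulrCA mulrA.
by rewrite form_orthogonal ?mulr0.
Qed.

Lemma adjoint_raise (g : nat -> M -> M) i m : (0 < i < n)%N ->
  (forall u u' : M, B (raise i u) u' = B u (g i u')) ->
  g i m = kpow i i%:Z (Fop i m).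
Proof.
move=> iN adj; apply: form_inj => x; rewrite -adj form_kpow -(B_adj iN).
rewrite (EopU x iN) formZ mulrA -expfzDr ?kap_neq0 // subrr expr0z.
by rewrite mul1r.
Qed.

End Shapovalov.

End Operators.

(** * The coefficients of the second Whittaker vector *)

Lemma big_change_two (A : Type) (idx : A) (op : Monoid.com_law idx)
    (n i : nat) (f g : nat -> A) (a b : A) : (0 < i < n)%N ->
  g i = op (f i) a -> g i.+1 = op (f i.+1) b ->
  (forall k, k != i -> k != i.+1 -> g k = f k) ->
  \big[op/idx]_(1 <= k < n.+1) g k =
  op (\big[op/idx]_(1 <= k < n.+1) f k) (op a b).
Proof.
move=> iN gi gi1 gk.
pose h k := if k == i then a else if k == i.+1 then b else idx.
have i1i : (i.+1 == i) = false by apply/eqP; lia.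
rewrite (eq_bigr (fun k => op (f k) (h k))) => [|k _]; last first.
  rewrite /h; have [->|ki] := eqVneq k i; first exact: gi.
  have [->|ki1] := eqVneq k i.+1; first exact: gi1.
  by rewrite gk // Monoid.mulm1.
rewrite big_split; congr (op _ _).
have Ui : uniq (index_iota 1 n.+1) by rewrite iota_uniq.
have iI : i \in index_iota 1 n.+1 by rewrite mem_index_iota; lia.
have i1I : i.+1 \in rem i (index_iota 1 n.+1).
  by rewrite mem_rem_uniq // !inE mem_index_iota; lia.
rewrite (big_rem i iI) (big_rem i.+1 i1I) /= /h eqxx i1i eqxx.
rewrite big_seq big1 ?Monoid.mulm1 // => k.
rewrite mem_rem_uniq ?rem_uniq // inE => /andP[/negPf->].
by rewrite mem_rem_uniq // inE => /andP[/negPf->].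
Qed.

Section WhittakerCoef.
Variables (F : fieldType) (n : nat) (t : nat -> F) (v : F).
Hypothesis gen : generic_params n t v.
Implicit Types (d : degree n) (i : nat).

Definition kscal i d : F :=
  t i.+1 * (t i)^-1 *
  v ^ (2 * (dg d i)%:Z - (dg d i.-1)%:Z - (dg d i.+1)%:Z + 1).

Definition wexp d : int :=
  \sum_(1 <= i < n) (1 - 2 * i%:Z) * (dg d i)%:Z ^+ 2
  - \sum_(2 <= i < n) (2 - 2 * i%:Z) * (dg d i)%:Z * (dg d i.-1)%:Z
  - \sum_(1 <= i < n) (dg d i)%:Z.

Definition wcoefF d : F :=
  v ^ wexp d *
  \prod_(1 <= i < n.+1) t i ^ ((2 - 2 * i%:Z) * ((dg d i.-1)%:Z - (dg d i)%:Z)).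

Lemma wexpE d : (0 < n)%N ->
  wexp d = \sum_(1 <= i < n.+1) (1 - 2 * i%:Z) * (dg d i)%:Z ^+ 2
    - \sum_(1 <= i < n.+1) (2 - 2 * i%:Z) * (dg d i)%:Z * (dg d i.-1)%:Z
    - \sum_(1 <= i < n.+1) (dg d i)%:Z.
Proof.
move=> n0; rewrite !big_nat_recr //= dg_out //; congr (_ - _ - _).
- by rewrite expr0n /= mulr0 addr0.
- rewrite mulr0 mul0r addr0; case: (ltnP 1 n) => n1.
    by rewrite [RHS]big_ltn // subrr !mul0r add0r.
  by rewrite !big_geq //; lia.
- by rewrite addr0.
Qed.

Lemma wexp_incr d i : (0 < i < n)%N ->
  wexp (incr d i) = wexp d + ((1 - 2 * i%:Z) * (2 * (dg d i)%:Z + 1)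
    - (2 - 2 * i%:Z) * (dg d i.-1)%:Z
    - (2 - 2 * i.+1%:Z) * (dg d i.+1)%:Z - 1).
Proof.
move=> iN; have n0 : (0 < n)%N by lia.
have SE (m : nat) : (m + true)%N%:Z = m%:Z + 1 by lia.
have ii1 : (i.+1 == i) = false by apply/eqP; lia.
have i1i : (i.-1 == i) = false by apply/eqP; lia.
rewrite !wexpE //.
rewrite (@big_change_two _ _ _ n i (fun k => (1 - 2 * k%:Z) * (dg d k)%:Z ^+ 2)
  (fun k => (1 - 2 * k%:Z) * (dg (incr d i) k)%:Z ^+ 2)
  ((1 - 2 * i%:Z) * (2 * (dg d i)%:Z + 1)) 0) //; last 3 first.
- by rewrite /= dg_incr // eqxx SE /=; ring.
- by rewrite /= dg_incr // ii1 addn0 /= addr0.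
- by move=> k /negPf ki _; rewrite dg_incr // ki addn0.
rewrite (@big_change_two _ _ _ n i
  (fun k => (2 - 2 * k%:Z) * (dg d k)%:Z * (dg d k.-1)%:Z)
  (fun k => (2 - 2 * k%:Z) * (dg (incr d i) k)%:Z * (dg (incr d i) k.-1)%:Z)
  ((2 - 2 * i%:Z) * (dg d i.-1)%:Z)
  ((2 - 2 * i.+1%:Z) * (dg d i.+1)%:Z)) //; last 3 first.
- by rewrite /= !dg_incr // eqxx i1i addn0 SE /=; ring.
- by rewrite /= !dg_incr // ii1 eqxx addn0 SE /=; ring.
- move=> k /negPf ki ki1; rewrite !dg_incr // ki.
  have [ki'|_] := eqVneq k.-1 i; last by rewrite !addn0.
  have k0 : k = 0%N by lia.
  by move: ki' ki; rewrite k0 => <-.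
rewrite (@big_change_two _ _ _ n i (fun k => (dg d k)%:Z)
  (fun k => (dg (incr d i) k)%:Z) 1 0) //; last 3 first.
- by rewrite /= dg_incr // eqxx SE.
- by rewrite /= dg_incr // ii1 addn0 /= addr0.
- by move=> k /negPf ki _; rewrite dg_incr // ki addn0.
by rewrite /=; ring.
Qed.

Lemma wcoef_incr d i : (0 < i < n)%N ->
  kscal i d ^ i%:Z * kscal i d ^ i%:Z * wcoefF (incr d i) *
  (t i ^+ 2 * v ^ (2 * ((dg d i.-1)%:Z - (dg d i)%:Z))) = wcoefF d.
Proof.
case: gen => v0 t0 _ iN.
have SE (m : nat) : (m + true)%N%:Z = m%:Z + 1 by lia.
have ii1 : (i.+1 == i) = false by apply/eqP; lia.
have i1i : (i.-1 == i) = false by apply/eqP; lia.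
have ti : t i != 0 by apply: t0; lia.
have ti1 : t i.+1 != 0 by apply: t0; lia.
rewrite /wcoefF wexp_incr // (@big_change_two _ _ _ n i
  (fun k => t k ^ ((2 - 2 * k%:Z) * ((dg d k.-1)%:Z - (dg d k)%:Z)))
  (fun k => t k ^ ((2 - 2 * k%:Z) *
    ((dg (incr d i) k.-1)%:Z - (dg (incr d i) k)%:Z))) (t i ^ (- (2 - 2 * i%:Z))) (t i.+1 ^ (2 - 2 * i.+1%:Z))) //; last 3 first.
- rewrite /= -expfzDr // !dg_incr // eqxx i1i; congr (_ ^ _).
  by rewrite addn0 SE; ring.
- rewrite /= -expfzDr // !dg_incr // eqxx ii1; congr (_ ^ _).
  by rewrite addn0 SE; ring.
- move=> k /negPf ki ki1; rewrite !dg_incr // ki.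
  have [ki'|_] := eqVneq k.-1 i; last by rewrite !addn0.
  have k0 : k = 0%N by lia.
  by move: ki' ki; rewrite k0 => <-.
rewrite /= /kscal !expfzMl !exprz_inv !exprz_exp [t i ^+ 2](exprnP (t i) 2).
set P := \prod_(1 <= k < n.+1) _.
have SiE : i.+1%:Z = i%:Z + 1 by lia.
set a := t i.+1 ^ i; set b := t i ^ (- i%:Z); set c := v ^ (_ * i%:Z).
set e := v ^ (wexp d + _); set f := t i ^ _; set g := t i.+1 ^ _.
set h := t i ^ 2; set k := v ^ _.
have E1 : a * a * g = 1.
  rewrite /a /g -!expfzDr // SiE.
  by set m := (X in _ ^ X); have -> : m = 0 by rewrite /m; ring.
have E2 : b * b * f * h = 1.
  rewrite /b /f /h -!expfzDr //.
  by set m := (X in _ ^ X); have -> : m = 0 by rewrite /m; ring.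
have E3 : c * c * e * k = v ^ wexp d.
  rewrite /c /e /k -!expfzDr // SiE; congr (_ ^ _); ring.
transitivity (a * a * g * (b * b * f * h) * (c * c * e * k) * P); last first.
  by rewrite E1 E2 E3 !mul1r.
by clearbody a b c e f g h k P; ring.
Qed.

End WhittakerCoef.

Lemma dg_deg0 n k : dg (deg0 n) k = 0%N.
Proof.
by rewrite -fdeg_fixpt0 dg_fdeg big1 // => j _; rewrite ent_fixpt0.
Qed.

Lemma schi_fixpt0 (R : realType) (F : fieldType) n (t : nat -> F) v :
  schi n t v R (chainQ (fixpt0 n)) = 1.
Proof.
have h0 : height n (chainQ (fixpt0 n)) = 0%N.
  rewrite /height big_map big1 // => i _.
  by rewrite big1 // => j _; rewrite /= ent_fixpt0.
rewrite /schi h0 big1 // => j _; rewrite big1 // => l _.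
by rewrite big_geq.
Qed.

Lemma wcoef_deg0 (F : fieldType) n (t : nat -> F) v : wcoefF t v (deg0 n) = 1.
Proof.
rewrite /wcoefF /wexp big1 => [|i _]; last by rewrite dg_deg0 expr0n mulr0.
rewrite big1 => [|i _]; last by rewrite dg_deg0 mulr0 mul0r.
rewrite big1 => [|i _]; last by rewrite dg_deg0.
rewrite !subr0 expr0z mul1r big1 // => i _.
by rewrite !dg_deg0 subrr mulr0 expr0z.
Qed.

(* The data of Defs.v over an arbitrary field with parameters t_1, ..., t_n, v;
   the theorem is the case of [Ffield R n]. *)
Section Generic.
Variables (R : realType) (F : fieldType) (n : nat) (t : nat -> F) (v : F).
Hypothesis hn : (2 <= n)%N.
Hypothesis gen : generic_params n t v.
Implicit Types (x y : fixpt n) (i : nat) (d : degree n).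

Local Notation M := {malg F[fixpt n]}.

Definition chiQ x : F := schi n t v R (chainQ x).
Definition chiE i x y : F := schi n t v R (chainE i x y).

Definition fibre_char i x y : F :=
  \sum_(1 <= j < i.+1) \sum_(ent x i j <= m < ent y i j)
    t j ^+ 2 * v ^- (2 * m).

Definition raise_scal i x : F :=
  - ((t i.+1)^-1 * (t i)^-1 *
     v ^ ((dg (fdeg x) i.+1)%:Z - (dg (fdeg x) i.-1)%:Z)).

Lemma chiE_neq0 i x y : (0 < i < n)%N -> y \in covers i x -> chiE i x y != 0.
Proof. by move=> iN yx; apply: schi_chainE_neq0. Qed.

Lemma chiQ_neq0 x : chiQ x != 0.
Proof. exact: schi_chainQ_neq0. Qed.

Lemma fibre_char_neq0 i x y : (0 < i < n)%N -> y \in covers i x ->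
  fibre_char i x y != 0.
Proof.
move=> iN /coversP[p [pi ok ->]]; rewrite /fibre_char fibre_char_addbox //.
by apply: (@gen_char_neq0 F n t v gen); lia.
Qed.

Lemma kscal_neq0 i d : (0 < i < n)%N -> kscal t v i d != 0.
Proof.
case: gen => v0 t0 _ iN; rewrite mulf_neq0 ?expfz_neq0 //.
by rewrite mulf_neq0 ?invr_neq0 // t0; lia.
Qed.

Lemma raise_scal_neq0 i x : (0 < i < n)%N -> raise_scal i x != 0.
Proof.
case: gen => v0 t0 _ iN; rewrite oppr_eq0 mulf_neq0 ?expfz_neq0 //.
by rewrite mulf_neq0 ?invr_neq0 // t0; lia.
Qed.

Local Notation lowerF := (lower chiE chiQ).
Local Notation raiseF := (raise chiE chiQ raise_scal fibre_char).
Local Notation kpowF := (kpow (kscal t v)).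
Local Notation whit T := (whittaker T (1 - v ^+ 2)^-1).

Lemma whittaker_lower (k : degree n -> M) :
  whit lowerF k <-> forall d, k d = kclass chiQ d (fun=> 1).
Proof.
have T1 i (m : M) x : (0 < i < n)%N ->
    mcoeff x (lowerF i m) = 1 * mcoeff x (lowerF i m) by rewrite mul1r.
have W : whit lowerF (fun d => 1 *: kclass chiQ d (fun=> 1)).
  apply: (@whittaker_kclass F n chiE chiQ chiQ_neq0 (schi_fixpt0 R n t v) lowerF
    (fun _ _ => 1) _ T1 (fun=> 1) (fun=> 1)) => [|i x iN /=];
      first exact: mulr1.
  rewrite !mul1r; under eq_bigr do rewrite mulr1.
  by rewrite sum_schi_covers // mulrC.
have E d : 1 *: kclass chiQ d (fun=> 1) = kclass chiQ d (fun=> 1) :> M.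
  exact: scale1r.
split=> [Wk d|kE].
  rewrite -E; apply: (@whittaker_unique F n chiE chiQ chiE_neq0 chiQ_neq0 lowerF
    (fun _ _ => 1) _ _ T1 _ _ Wk W) => i m _; exact: oner_neq0.
by apply: eq_whittaker W => d; rewrite kE E.
Qed.

Lemma whittaker_adjoint (B : M -> M -> F) (g : nat -> M -> M) :
  (forall u : M, scalar (fun m => B m u)) ->
  (forall u u' : M, B u u' = B u' u) ->
  B << fixpt0 n >> << fixpt0 n >> = 1 ->
  (forall i, (0 < i < n)%N -> forall u u' : M,
    B (raiseF i (kpowF i (- i%:Z) u)) u' = B u (kpowF i i%:Z (lowerF i u'))) ->
  (forall i, (0 < i < n)%N -> forall u u' : M,
    B (raiseF i u) u' = B u (g i u')) ->
  forall w, whit g w <-> forall d,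
    w d = (wcoefF t v d * det_char t v (fixpt0 n)) *:
          kclass chiQ d (fun x => (det_char t v x)^-1).
Proof.
move=> B_lin B_sym B_vac B_adj g_adj w.
pose mu i d := kscal t v i d ^ i%:Z * kscal t v i d ^ i%:Z.
have mu0 i d : (0 < i < n)%N -> mu i d != 0.
  by move=> iN; rewrite mulf_neq0 ?expfz_neq0 ?kscal_neq0.
have gE i (m : M) x : (0 < i < n)%N ->
    mcoeff x (g i m) = mu i (fdeg x) * mcoeff x (lowerF i m).
  move=> iN.
  have -> : g i m = kpowF i i%:Z (kpowF i i%:Z (lowerF i m)).
    exact: (@adjoint_raise F n chiE chiQ (kscal t v) raise_scal fibre_char
      chiE_neq0 chiQ_neq0 kscal_neq0 raise_scal_neq0 fibre_char_neq0 B B_lin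
      B_sym B_vac B_adj g i m iN (g_adj i iN)).
  apply: (etrans (mcoeff_kpow _ i i%:Z (kpowF i i%:Z (lowerF i m)) x)).
  rewrite -[RHS]mulrA; congr (_ * _); exact: mcoeff_kpow.
have D0 x : det_char t v x != 0 by apply: det_char_neq0.
have W : whit g (fun d => (wcoefF t v d * det_char t v (fixpt0 n)) *:
    kclass chiQ d (fun x => (det_char t v x)^-1)).
  apply: (@whittaker_kclass F n chiE chiQ chiQ_neq0 (schi_fixpt0 R n t v) g
    mu _ gE (fun d => wcoefF t v d * det_char t v (fixpt0 n))
    (fun x => (det_char t v x)^-1)) => [|i x iN /=].
    by rewrite wcoef_deg0 mul1r divff.
  have S := @sum_schi_covers_char R F n t v hn gen i x
    (fun y => det_char t v x / det_char t v y) iN (fun p pi ok =>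
      det_char_addbox hn gen iN pi ok).
  have {}S : \sum_(y <- covers i x) chiE i x y / det_char t v y =
    (det_char t v x)^-1 * (chiQ x / (1 - v ^+ 2) * (t i ^+ 2 *
      v ^ (2 * ((dg (fdeg x) i.-1)%:Z - (dg (fdeg x) i)%:Z)))).
    rewrite -S mulr_sumr; apply: eq_bigr => y _.
    by rewrite mulrCA mulKf.
  rewrite S -(wcoef_incr gen (fdeg x) iN) /mu.
  set a := kscal t v i _ ^ _; set b := wcoefF _ _ _; set c := det_char _ _ _.
  set e := (det_char _ _ _)^-1; set f := t i ^+ 2 * _; set h := (1 - _)^-1.
  by clearbody a b c e f h; ring.
split=> [Ww d|wE].
  exact: (@whittaker_unique F n chiE chiQ chiE_neq0 chiQ_neq0 g mu _ mu0 gE w _ Ww W).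
exact: eq_whittaker wE W.
Qed.

End Generic.

Unset Implicit Arguments.

(* The factor [Dchar R (fixpt0 n)], constant in [d], rescales D^{-1} so that it
   is trivial on Q_{(0,...,0)}, as required by w_{(0,...,0)} = [(0,...,0)]. *)
Theorem proposition2p31 (R : realType) (n : nat) (hn : (2 <= n)%N) :
  (forall k : degree n -> Mmod R n,
     is_whittaker (@fop R n) k <->
     forall d : degree n, k d = Kclass d (fun _ => 1)) /\
  (forall (B : Mmod R n -> Mmod R n -> Ffield R n)
          (estar : nat -> Mmod R n -> Mmod R n),
     is_shapovalov B ->
     (forall i, (0 < i < n)%N -> is_adjoint B (@eop R n i) (estar i)) ->
     forall w : degree n -> Mmod R n,
       is_whittaker estar w <->
       forall d : degree n,
         w d = (wcoef R d * Dchar R (fixpt0 n)) *: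
               Kclass d (fun x => (Dchar R x)^-1)).
Proof.
have gen := @generic_Ffield R n hn; split=> [k|B estar [B1 B2 B3 B4] adj w].
  exact: (@whittaker_lower R _ n _ _ hn gen k).
exact: (@whittaker_adjoint R _ n _ _ hn gen B estar B1 B2 B3 B4 adj w).
Qed.
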